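(* Let $\mathcal{G}$ be a finitely branching stochastic game with countable state space $S$, let $\mathcal{T} \subseteq S$, $c \in [0,1]$ and $\rhd \in \{\ge,>\}$. The threshold reachability objective $(\mathtt{Reach}(\mathcal{T}), \rhd c)$ is strongly MD-determined in $\mathcal{G}$, provided that at least one of the following conditions holds: (1) player $\Box$ does not have value-decreasing transitions, or (2) player $\Diamond$ does not have value-increasing transitions, or (3) the objective is almost-sure: $\rhd$ is $\ge$ and $c = 1$, or (4) the inequality is strict: $\rhd$ is $>$.
   Context: A (2-player turn-based stochastic) game is $\mathcal{G} = (S,(S_\Box,S_\Diamond,S_\bigcirc),\longrightarrow,P)$, where $S$ is a countable set of states partitioned into the states $S_\Box$ of player $\Box$ (maximizer), the states $S_\Diamond$ of player $\Diamond$ (minimizer) and the random states $S_\bigcirc$; $\longrightarrow\, \subseteq S\times S$ is the transition relation, such that every state has at least one successor ($s'$ is a successor of $s$ if $s \longrightarrow s'$); and $P$ assigns to each $s \in S_\bigcirc$ a probability distribution over its successors. The game is finitely branching if each state has only finitely many successors. A strategy of player $\Box$ is a function $\sigma$ assigning to each finite sequence $ws \in S^*S_\Box$ a probability distribution over the successors of $s$; strategies $\pi$ of player $\Diamond$ are defined analogously on $S^*S_\Diamond$. (Strategies may be history-dependent and randomized.) A strategy is MD (memoryless deterministic) if it chooses with probability 1 a single successor that depends only on the current state $s$. Given an initial state $s_0$ and strategies $\sigma,\pi$, $\mathcal{P}_{\mathcal{G},s_0,\sigma,\pi}$ is the unique probability measure on the Borel $\sigma$-algebra of $s_0S^\omega$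 (generated by cylinder sets) with $\mathcal{P}_{\mathcal{G},s_0,\sigma,\pi}(s_0 s_1\cdots s_n S^\omega) = \prod_{i=0}^{n-1} \tau(s_0\cdots s_i)(s_{i+1})$, where $\tau(ws)$ equals $\sigma(ws)$, $\pi(ws)$ or $P(s)$ according to whether $s \in S_\Box$, $S_\Diamond$ or $S_\bigcirc$. For $\mathcal{E} \subseteq S^\omega$, $\mathcal{P}_{\mathcal{G},s_0,\sigma,\pi}(\mathcal{E})$ means $\mathcal{P}_{\mathcal{G},s_0,\sigma,\pi}(\mathcal{E}\cap s_0S^\omega)$. $\mathtt{Reach}(\mathcal{T}) = \{s_0s_1\cdots\in S^\omega \mid \exists i \ge 0.\ s_i\in\mathcal{T}\}$. The value of a state with respect to $\mathtt{Reach}(\mathcal{T})$ is $\mathtt{val}_{\mathcal{G}}(s) = \sup_\sigma\inf_\pi \mathcal{P}_{\mathcal{G},s,\sigma,\pi}(\mathtt{Reach}(\mathcal{T})) = \inf_\pi\sup_\sigma \mathcal{P}_{\mathcal{G},s,\sigma,\pi}(\mathtt{Reach}(\mathcal{T}))$ (the equality is a known theorem: countable stochastic games with Borel objectives are weakly determined). A transition $s\longrightarrow s'$ is value-decreasing if $\mathtt{val}_{\mathcal{G}}(s) > \mathtt{val}_{\mathcal{G}}(s')$ and value-increasing if $\mathtt{val}_{\mathcal{G}}(s) < \mathtt{val}_{\mathcal{G}}(s')$. A player has such a transition if the player controls it, i.e. the source $s$ belongs to $S_\Box$ (for player $\Box$) resp. $S_\Diamond$ (for player $\Diamond$). A threshold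 objective $(\mathcal{E},\rhd c)$ is strongly MD-determined in $\mathcal{G}$ iff for every state $s\in S$ either there is an MD strategy $\sigma$ of player $\Box$ such that for all player $\Diamond$ strategies $\pi$ (not necessarily MD), $\mathcal{P}_{\mathcal{G},s,\sigma,\pi}(\mathcal{E}) \rhd c$; or there is an MD strategy $\pi$ of player $\Diamond$ such that for all player $\Box$ strategies $\sigma$ (not necessarily MD), it is not the case that $\mathcal{P}_{\mathcal{G},s,\sigma,\pi}(\mathcal{E}) \rhd c$. *)

(* Defs.v *)
(* MathComp / MathComp-Analysis *)
From HB Require Import structures.
From mathcomp Require Import all_boot all_order all_algebra.
From mathcomp Require Import all_classical all_reals all_analysis.

Set Implicit Arguments.
Unset Strict Implicit.
Unset Printing Implicit Defensive.

Import Order.TTheory GRing.Theory Num.Theory.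

Local Open Scope classical_set_scope.
Local Open Scope ring_scope.

Definition is_distr (R : realType) (S : choiceType) (A : set S) (f : S -> R) :
    Prop :=
  [/\ forall t, 0 <= f t,
      forall t, ~ A t -> f t = 0
    & \esum_(t in A) (f t)%:E = 1%E].

(* Box is the maximizer, Diamond the minimizer. *)
Inductive player := Box | Diamond.

(* The three fibers of [owner] partition the states; [None] marks the random
   states. The function [prob] is meaningless outside the random states. *)
Record game (R : realType) (S : countType) := Game {
  owner : S -> option player;
  succ : S -> set S;
  succ_neq0 : forall s, succ s !=set0;
  prob : S -> S -> R;
  probP : forall s, owner s = None -> is_distr (succ s) (prob s) }.

Definition finitely_branching (R : realType) (S : countType) (G : game R S) :
    Prop :=
  forall s, finite_set (succ G s).

(* [sigma w s] is the distribution chosen after the history [w s]; it is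
   meaningless when [s] does not belong to the player [p]. *)
Record strategy (R : realType) (S : countType) (G : game R S) (p : player) :=
  Strategy {
    strat :> seq S -> S -> S -> R;
    stratP : forall w s, owner G s = Some p -> is_distr (succ G s) (strat w s) }.

Definition is_MD (R : realType) (S : countType) (G : game R S) (p : player)
    (sigma : strategy G p) : Prop :=
  exists f : S -> S, forall w s, owner G s = Some p -> sigma w s (f s) = 1.

(* Infinite sequences of states. Measurable types of the library are pointed;
   the parameter [s0] only serves to provide a point, so that the set of states
   need not be assumed to be inhabited. *)
Definition plays (S : countType) (s0 : S) := nat -> S.
HB.instance Definition _ (S : countType) (s0 : S) :=
  Choice.on (plays s0).
HB.instance Definition _ (S : countType) (s0 : S) :=
  isPointed.Build (plays s0) (fun=> s0).

(* The plays that extend the finite sequence [x 0, ..., x n]. *)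
Definition cylinder (S : countType) (s0 : S) (x : nat -> S) (n : nat) :
    set (plays s0) :=
  [set r | forall i, (i <= n)%N -> r i = x i].

Definition cylinders (S : countType) (s0 : S) : set (set (plays s0)) :=
  [set C | exists x n, C = cylinder x n].

Definition play_space (S : countType) (s0 : S) :=
  g_sigma_algebraType (@cylinders S s0).

Definition tau (R : realType) (S : countType) (G : game R S)
    (sigma : strategy G Box) (pi : strategy G Diamond) (w : seq S) (s : S) :
    S -> R :=
  match owner G s with
  | Some Box => sigma w s
  | Some Diamond => pi w s
  | None => prob G s
  end.

(* Here [mkseq x i] is the sequence [x 0, ..., x i.-1]. The case [n = 0] says
   that the play starts in [s0] almost surely. *)
Definition is_play_law (R : realType) (S : countType) (G : game R S) (s0 : S)
    (sigma : strategy G Box) (pi : strategy G Diamond)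
    (P : probability (play_space s0) R) : Prop :=
  forall (x : nat -> S) (n : nat), x 0%N = s0 ->
    P (cylinder x n) =
      (\prod_(i < n) tau sigma pi (mkseq x i) (x i) (x i.+1))%:E.

(* The unique probability measure with the prescribed values on cylinders; it
   exists by the Ionescu-Tulcea theorem. *)
Definition play_law (R : realType) (S : countType) (G : game R S) (s0 : S)
    (sigma : strategy G Box) (pi : strategy G Diamond) :
    probability (play_space s0) R :=
  get [set P : probability (play_space s0) R | is_play_law sigma pi P].

Definition Reach (S : countType) (T : set S) : set (nat -> S) :=
  [set r | exists i, T (r i)].

Definition reach_value (R : realType) (S : countType) (G : game R S) (T : set S)
    (s : S) : \bar R :=
  ereal_sup (range (fun sigma : strategy G Box =>
    ereal_inf (range (fun pi : strategy G Diamond =>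
      play_law s sigma pi (Reach T))))).

Definition value_decreasing (R : realType) (S : countType) (G : game R S)
    (T : set S) (s t : S) : Prop :=
  succ G s t /\ (reach_value G T t < reach_value G T s)%E.

Definition value_increasing (R : realType) (S : countType) (G : game R S)
    (T : set S) (s t : S) : Prop :=
  succ G s t /\ (reach_value G T s < reach_value G T t)%E.

Inductive comparison_sign := Geq | Gtr.

Definition meets_threshold (R : realType) (p : \bar R) (rhd : comparison_sign)
    (c : R) : Prop :=
  match rhd with
  | Geq => (c%:E <= p)%E
  | Gtr => (c%:E < p)%E
  end.

Definition strongly_MD_determined (R : realType) (S : countType)
    (G : game R S) (E : set (nat -> S)) (rhd : comparison_sign) (c : R) :
    Prop :=
  forall s : S,
    (exists sigma : strategy G Box, is_MD sigma /\
       forall pi : strategy G Diamond,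
         meets_threshold (play_law s sigma pi E) rhd c)
    \/
    (exists pi : strategy G Diamond, is_MD pi /\
       forall sigma : strategy G Box,
         ~ meets_threshold (play_law s sigma pi E) rhd c).

(* Main.v *)
From HB Require Import structures.
Require Import Defs.
From mathcomp Require Import all_boot all_order all_algebra.
From mathcomp Require Import all_classical all_reals all_analysis.
From mathcomp Require Import ring lra.

Set Implicit Arguments.
Unset Strict Implicit.
Unset Printing Implicit Defensive.

Import Order.TTheory GRing.Theory Num.Theory.

Local Open Scope classical_set_scope.
Local Open Scope ring_scope.

(* Since the game is finitely branching, the value is the limit [v] of value
   iteration and the Diamond player has an optimal MD strategy, which minimizes
   [v]. If [v s > c], then for some discount factor below 1 the discounted value
   still exceeds [c] at [s], and the MD strategy of the Box player that maximizes
   it guarantees more than [c]. There remains the objective [>= c] when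
   [v s = c].
   If the Box player has no value-decreasing edges, an MD strategy that secures a
   fixed fraction of [v] at all states already secures [v], because [v] is then
   a submartingale. Such a strategy arises by thinning out the edges of the Box
   player once for every state: fixing moves that maximize a discounted value
   wherever this value exceeds some [e > 0] does not change the value of the
   game.
   In the other two cases let [g] be [v], respectively the constant 1: no move
   increases [g] in expectation. Take a maximal set [D] of states on which some
   MD strategy of the Diamond player keeps the probability below [g]. Confined to
   the edges that preserve [g] and avoid [D], the Box player has value [g] outside
   of [D], hence an optimal MD strategy by the first case. *)

(** * The one-step operator of value iteration *)

Section ValueIteration.
Context (R : realType) (S : countType) (G : game R S) (T : set S).
Context (fb : finitely_branching G).

Definition succs (s : S) : seq S := finmap.enum_fset (fset_set (succ G s)).

Lemma mem_succs s y : y \in succs s <-> succ G s y.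
Proof.
by rewrite /succs (in_fset_set (fb s)); split => [/set_mem|/mem_set].
Qed.

Lemma has_succs s : exists y, y \in succs s.
Proof. by have [y sy] := succ_neq0 G s; exists y; apply/mem_succs. Qed.

Lemma distr_sum s (f : S -> R) : is_distr (succ G s) f ->
  \sum_(y <- succs s) f y = 1.
Proof.
move=> [f0 _]; rewrite esum_fset//; last by move=> y _; rewrite lee_fin.
rewrite fsbig_finite//= sumEFin => -[<-].
by [].
Qed.

(* The Box player is restricted to the edges of [E]. *)
Definition opt (E : S -> pred S) (x : S -> R) (s : S) : R :=
  match owner G s with
  | Some Box => \big[Num.max/0]_(y <- succs s | E s y) x y
  | Some Diamond => \big[Num.min/1]_(y <- succs s) x y
  | None => \sum_(y <- succs s) prob G s y * x y
  end.

(** Agrees with [c <= opt E x s] when [0 < c <= 1], but involves no default values, so that [c] and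
    [x] can be shifted out of the unit interval. *)
Definition secures (E : S -> pred S) (x : S -> R) (s : S) (c : R) : Prop :=
  match owner G s with
  | Some Box => exists y, [/\ y \in succs s, E s y & c <= x y]
  | Some Diamond => forall y, y \in succs s -> c <= x y
  | None => c <= \sum_(y <- succs s) prob G s y * x y
  end.

Lemma secures_le_opt E x s c : c <= 1 -> secures E x s c -> c <= opt E x s.
Proof.
rewrite /secures /opt; case: (owner G s) => [[]|] c1 //.
  by case=> y [ys Ey cx]; apply: bigmax_sup_seq ys Ey cx.
by move=> H; rewrite big_seq; apply: le_bigmin => //.
Qed.

Lemma opt_secures E x s c : 0 < c -> c <= opt E x s -> secures E x s c.
Proof.
rewrite /secures /opt; case: (owner G s) => [[]|] c0 //.
  move=> H; apply/not_existsP => nH.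
  have : \big[Num.max/0]_(y <- succs s | E s y) x y < c.
    rewrite big_seq_cond; apply: bigmax_lt => // y /andP[ys Ey].
    by rewrite ltNge; apply/negP => cy; apply: (nH y).
  by rewrite ltNge H.
by move=> H y ys; apply: le_trans H _; exact: ge_bigmin_seq.
Qed.

Lemma sum_probB E x x' s d : owner G s = None ->
  (forall y, y \in succs s -> x y - d <= x' y) ->
  \sum_(y <- succs s) prob G s y * x y - d <= opt E x' s.
Proof.
move=> os H; rewrite /opt os.
have pD := probP os; have [p0 _ _] := pD.
rewrite -[d in _ - d]mul1r -(distr_sum pD) mulr_suml -sumrB.
rewrite !big_seq; apply: ler_sum => y ys.
by rewrite -mulrBr ler_wpM2l// H.
Qed.

Lemma secures_shift E x x' s c d :
  (forall y, y \in succs s -> x y - d <= x' y) ->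
  secures E x s c -> secures E x' s (c - d).
Proof.
move=> H; have := @sum_probB E x x' s d; rewrite /secures /opt.
case os: (owner G s) => [[]|] K.
- move=> [y [ys Ey cy]]; exists y; split=> //.
  by apply: le_trans (H y ys); rewrite lerD2r.
- move=> cy y ys.
  by apply: le_trans (H y ys); rewrite lerD2r cy.
- by move=> cx; apply: le_trans (K erefl H); rewrite lerD2r.
Qed.

Lemma opt_shift E x x' s d : 0 <= d ->
  (forall y, y \in succs s -> x y <= x' y + d) ->
  opt E x s <= opt E x' s + d.
Proof.
move=> d0 H.
have H' y : y \in succs s -> x y - d <= x' y by move/H; rewrite lerBlDr.
have := @sum_probB E x x' s d; rewrite /opt.
case: (owner G s) => [[]|] K.
- rewrite big_seq_cond; apply: bigmax_le.
    by rewrite addr_ge0// bigmax_ge_id.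
  move=> y /andP[ys Ey]; apply: le_trans (H y ys) _.
  by rewrite lerD2r; exact: le_bigmax_seq.
- rewrite -lerBlDr [leRHS]big_seq; apply: le_bigmin.
    by rewrite lerBlDr (le_trans (bigmin_le_id _ _ _ _))// lerDl.
  move=> y ys; apply: le_trans (H' y ys).
  by rewrite lerD2r; exact: ge_bigmin_seq.
- by rewrite -lerBlDr K.
Qed.

Lemma le_opt E x x' s : (forall y, y \in succs s -> x y <= x' y) ->
  opt E x s <= opt E x' s.
Proof.
by move=> H; rewrite -[leRHS]addr0; apply: opt_shift => // y /H; rewrite addr0.
Qed.

Lemma opt_ge0 E x s : (forall y, 0 <= x y) -> 0 <= opt E x s.
Proof.
rewrite /opt => x0; case os: (owner G s) => [[]|].
- exact: bigmax_ge_id.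
- exact: le_bigmin.
- have [p0 _ _] := probP os.
  by apply: sumr_ge0 => y _; exact: mulr_ge0.
Qed.

Lemma opt_le1 E x s : (forall y, x y <= 1) -> opt E x s <= 1.
Proof.
rewrite /opt => x1; case os: (owner G s) => [[]|].
- exact: bigmax_le.
- exact: bigmin_le_id.
- have [p0 _ _] := probP os.
  rewrite -(distr_sum (probP os)); apply: ler_sum => y _.
  by rewrite ler_piMr.
Qed.

Lemma bigmax_attained (E : S -> pred S) (x : S -> R) s y0 : (forall y, 0 <= x y) ->
  y0 \in succs s -> E s y0 ->
  exists y, [/\ y \in succs s, E s y &
    x y = \big[Num.max/0]_(y <- succs s | E s y) x y].
Proof.
move=> x0 ys Ey; set m := \big[_/_]_(_ <- _ | _) _.
have [m0|m0] := ltP 0 m.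
  apply/not_existsP => nH.
  have : m < m.
    rewrite {1}/m big_seq_cond; apply: bigmax_lt => // y /andP[y_s y_E].
    rewrite lt_neqAle le_bigmax_seq // andbT.
    by apply/eqP => ym; apply: (nH y).
  by rewrite ltxx.
(* The maximum is at most 0 and [x] is nonnegative, so every allowed successor attains it. *)
exists y0; split=> //; apply/eqP; rewrite eq_le (le_trans m0)// andbT.
exact: le_bigmax_seq.
Qed.

(** The default 1 of the minimum does not scale with [a], hence the bound [a <= 1] and a mere
    inequality. *)
Lemma opt_scale E x s a : 0 <= a <= 1 -> (forall y, 0 <= x y) ->
  a * opt E x s <= opt E (fun y => a * x y) s.
Proof.
move=> /andP[a0 a1] x0; rewrite /opt; case: (owner G s) => [[]|].
- have [[y0 [ys Ey]]|nE] := pselect (exists y, y \in succs s /\ E s y).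
    have [y [y_s y_E <-]] := bigmax_attained x0 ys Ey.
    exact: (le_bigmax_seq 0 y (E s) (fun y => a * x y)).
  rewrite big_seq_cond big_pred0; first by rewrite mulr0 bigmax_ge_id.
  by move=> y; apply/negP => /andP[ys Ey]; apply: nE; exists y.
- rewrite [leRHS]big_seq; apply: le_bigmin.
    by rewrite mulr_ile1// ?bigmin_le_id// le_bigmin.
  by move=> y ys; rewrite ler_wpM2l//; exact: ge_bigmin_seq.
- rewrite mulr_sumr le_eqVlt; apply/orP; left; apply/eqP.
  by apply: eq_bigr => y _; rewrite mulrCA.
Qed.

(** * Discounted values as limits of value iteration *)

Section Value.
Context (lam : R) (E : S -> pred S) (D : set S).

(* The states of [D] are losing for the Box player, and the payoff is
   discounted by [lam] at every step before [T] is reached. *)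
Fixpoint valn (n : nat) (s : S) : R :=
  if n is m.+1 then
    if s \in T then 1 else if s \in D then 0 else lam * opt E (valn m) s
  else 0.

Definition val (s : S) : R := sup (range (valn^~ s)).

Context (lam01 : 0 <= lam <= 1).

Lemma valn_ge0 n s : 0 <= valn n s.
Proof.
elim: n s => //= n IH s; case: ifP => // _; case: ifP => // _.
by move: lam01 => /andP[l0 _]; rewrite mulr_ge0// opt_ge0.
Qed.

Lemma valn_le1 n s : valn n s <= 1.
Proof.
elim: n s => //= n IH s; case: ifP => // _; case: ifP => // _.
move: lam01 => /andP[l0 l1]; rewrite mulr_ile1//.
  by rewrite opt_ge0//; exact: valn_ge0.
exact: opt_le1.
Qed.

Lemma valn_nd s : {homo valn^~ s : m n / (m <= n)%N >-> m <= n}.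
Proof.
apply: homo_leq => // [? ? ?|n]; first exact: le_trans.
elim: n s => [s|n IH s]; first exact: valn_ge0.
rewrite /=; case: ifP => // _; case: ifP => // _.
by move: lam01 => /andP[l0 _]; rewrite ler_wpM2l//; apply: le_opt.
Qed.

Let has_sup_valn s : has_sup (range (valn^~ s)).
Proof.
split; first by exists (valn 0 s), 0%N.
by exists 1 => _ [n _ <-]; exact: valn_le1.
Qed.

Lemma valn_le_val n s : valn n s <= val s.
Proof. by apply: sup_upper_bound => //; exists n. Qed.

Lemma val_le s c : (forall n, valn n s <= c) -> val s <= c.
Proof.
move=> H; apply: ge_sup; first by exists (valn 0 s), 0%N.
by move=> _ [n _ <-].
Qed.

Lemma val_ge0 s : 0 <= val s.
Proof. exact: le_trans (valn_ge0 0 s) (valn_le_val 0 s). Qed.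

Lemma val_le1 s : val s <= 1.
Proof. by apply: val_le => n; exact: valn_le1. Qed.

Lemma val_gt s c : c < val s -> exists n, c < valn n s.
Proof.
move=> cs; apply/not_existsP => H; move: cs; rewrite ltNge => /negP; apply.
by apply: val_le => n; rewrite leNgt; apply/negP; exact: H.
Qed.

Lemma val_target s : T s -> val s = 1.
Proof.
move=> Ts; apply/eqP; rewrite eq_le val_le1/=.
by rewrite -[leLHS]/((1 : R)) (le_trans _ (valn_le_val 1 s))//= mem_set.
Qed.

Lemma val_dead s : D s -> ~ T s -> val s = 0.
Proof.
move=> Ds nTs; apply/eqP; rewrite eq_le val_ge0 andbT.
by apply: val_le => -[//|n] /=; rewrite memNset// mem_set.
Qed.

Lemma val_step s : ~ T s -> ~ D s -> val s = lam * opt E val s.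
Proof.
move=> nTs nDs; move: (lam01) => /andP[l0 l1].
apply/eqP; rewrite eq_le; apply/andP; split.
  apply: val_le => -[|n] /=.
    by rewrite mulr_ge0// opt_ge0//; exact: val_ge0.
  rewrite !memNset// ler_wpM2l//; apply: le_opt => y _; exact: valn_le_val.
apply/ler_addgt0Pr => e e0.
(* Finite branching enters here: a single stage [n] is within [e] of the limit at all successors of
   [s]. *)
have [n Hn] : exists n, forall y, y \in succs s -> val y <= valn n y + e.
  elim: (succs s) => [|y r [n Hn]]; first by exists 0%N.
  have [m Hm] : exists m, val y - e < valn m y by apply: val_gt; rewrite gtrBl.
  exists (maxn m n) => z; rewrite inE => /orP[/eqP ->|/Hn zn].
    rewrite -lerBlDr (le_trans (ltW Hm))//; apply: valn_nd.
    exact: leq_maxl.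
  by rewrite (le_trans zn)// lerD2r; apply: valn_nd; exact: leq_maxr.
apply: (@le_trans _ _ (valn n.+1 s + e)); last by rewrite lerD2r valn_le_val.
rewrite /= !memNset//.
apply: (@le_trans _ _ (lam * (opt E (valn n) s + e))).
  by rewrite ler_wpM2l//; apply: opt_shift => //; exact: ltW.
by rewrite mulrDr lerD2l ler_piMl// ltW.
Qed.

End Value.

Let unit01 : 0 <= (1 : R) <= 1. Proof. by rewrite ler01 lexx. Qed.

(** The factor [lam] forces progress: where [w] exceeds [e], it must grow by [1 / lam] in
    expectation, yet it is bounded by 1. So [n] stages fall short of [w - e] by at most [lam ^+ n],
    which tends to 0. *)
Lemma certificate_le_val (lam e : R) E D (w : S -> R) :
  0 <= lam < 1 -> 0 <= e -> (forall s, w s <= 1) ->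
  (forall s, ~ T s -> e < w s ->
    ~ D s /\ secures E (fun y => lam * w y) s (w s)) ->
  forall s, w s - e <= val 1 E D s.
Proof.
move=> /andP[l0 l1] e0 w1 H s.
have valn_ge n : w s - e - lam ^+ n <= valn 1 E D n s.
  elim: n s => [|n IH] s.
    by rewrite expr0 /=; have := w1 s; lra.
  have ln0 : 0 <= lam ^+ n.+1 by rewrite exprn_ge0.
  have [we|ew] := leP (w s) e.
    by apply: le_trans (valn_ge0 _ _ unit01 _ _); lra.
  rewrite /=; case: ifPn => [_|/negP nT]; first by have := w1 s; lra.
  have nTs : ~ T s by move=> ?; apply: nT; rewrite inE.
  have [nDs sec] := H s nTs ew.
  rewrite memNset// mul1r; apply: secures_le_opt.
    by have := w1 s; lra.
  rewrite -addrA -opprD; apply: secures_shift sec => y _.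
  have v0 := valn_ge0 E D unit01 n y.
  have IHy := IH y.
  have H1 : lam * (w y - e - lam ^+ n) <= lam * valn 1 E D n y.
    by rewrite ler_wpM2l.
  have H2 : lam * valn 1 E D n y <= valn 1 E D n y by rewrite ler_piMl// ltW.
  have H3 : lam * e <= e by rewrite ler_piMl// ltW.
  by move: H1; rewrite exprS !mulrBr; lra.
rewrite leNgt; apply/negP => lt_val.
have d0 : 0 < w s - e - val 1 E D s by rewrite subr_gt0.
have lam_lt1 : `|lam| < 1 by rewrite ger0_norm.
have /cvgrPdist_lt /(_ _ d0) [n _ Hn] := cvg_expr lam_lt1.
have := Hn n (leqnn n); rewrite /= sub0r normrN ger0_norm ?exprn_ge0//.
have := valn_ge n; have := valn_le_val E D unit01 n s.
lra.
Qed.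

(** By its fixpoint equation the discounted value is a certificate for the undiscounted game. The
    edges of [E'] have to be good only where this value exceeds [e]. *)
Lemma discounted_le_val (lam e : R) (E E' : S -> pred S) D :
  0 <= lam < 1 -> 0 <= e ->
  (forall s, owner G s = Some Box -> ~ T s -> ~ D s -> e < val lam E D s ->
    exists y, [/\ y \in succs s, E' s y &
      val lam E D s <= lam * val lam E D y]) ->
  forall s, val lam E D s - e <= val 1 E' D s.
Proof.
move=> /andP[l0 l1] e0 H.
have lam01 : 0 <= lam <= 1 by rewrite l0 ltW.
apply: (@certificate_le_val lam) => //; first by rewrite l0.
  by move=> s; exact: val_le1.
move=> s nTs es.
have nDs : ~ D s.
  by move=> Ds; move: es; rewrite (val_dead _ lam01 Ds nTs) ltNge e0.
split=> //.
have v0 : 0 < val lam E D s by exact: le_lt_trans es.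
have := val_step E lam01 nTs nDs.
have := H s; rewrite /secures /opt; case: (owner G s) => [[]|] K vs.
- by have [y [ys Ey Hy]] := K erefl nTs nDs es; exists y.
- move=> y ys; rewrite {1}vs ler_wpM2l//; exact: ge_bigmin_seq.
- rewrite {1}vs mulr_sumr le_eqVlt; apply/orP; left; apply/eqP.
  by apply: eq_bigr => y _; rewrite mulrCA.
Qed.

(** Some finite stage [n] already exceeds [c], and discounting by [1 - d] scales it by no less than
    [(1 - d) ^+ n >= 1 - n * d]. *)
Lemma discounted_approx E D s c : 0 <= c -> c < val 1 E D s ->
  exists lam, 0 <= lam < 1 /\ c < val lam E D s.
Proof.
move=> c0 /val_gt[n cn]; set b := valn 1 E D n s in cn.
have b1 : b <= 1 := valn_le1 E D unit01 n s.
(* Since [b <= 1], this choice gives [b * (1 - n * d) >= b - n * d = c + d]. *)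
pose d := (b - c) / n.+1%:R.
have nd : n.+1%:R * d = b - c by rewrite mulrC divfK// pnatr_eq0.
have n1 : 1 <= n.+1%:R :> R by rewrite ler1n.
have d0 : 0 < d by rewrite divr_gt0// subr_gt0.
have d1 : d <= 1 by nra.
have lam01 : 0 <= 1 - d <= 1 by lra.
exists (1 - d); split; first by lra.
have scale m t : (1 - d) ^+ m * valn 1 E D m t <= valn (1 - d) E D m t.
  elim: m t => [|m IH] t; first by rewrite /= mulr0.
  rewrite /=; case: ifP => _.
    by rewrite mulr1 exprn_ile1//; lra.
  case: ifP => _; first by rewrite mulr0.
  rewrite mul1r exprS -mulrA ler_wpM2l//; first by lra.
  apply: le_trans (opt_scale _ _ _ _) _.
  - by rewrite exprn_ge0 ?exprn_ile1//; lra.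
  - by move=> y; exact: valn_ge0.
  - by apply: le_opt => y _; exact: IH.
have bern m : 1 - m%:R * d <= (1 - d) ^+ m.
  elim: m => [|m IH]; first by rewrite mul0r subr0 expr0.
  have m0 : 0 <= m%:R :> R by rewrite ler0n.
  rewrite exprS -natr1; apply: le_trans (_ : _ <= (1 - d) * (1 - m%:R * d)) _.
    by nra.
  by rewrite ler_wpM2l//; lra.
apply: lt_le_trans (valn_le_val _ _ lam01 n s).
apply: lt_le_trans (scale n s); rewrite -/b.
apply: lt_le_trans (_ : c < b * (1 - n%:R * d)) _.
  have : n%:R * d = b - c - d by rewrite -nd -natr1 mulrDl mul1r addrK.
  have : 0 <= n%:R * d by rewrite mulr_ge0// ltW.
  nra.
rewrite [leRHS]mulrC ler_wpM2l//.
by rewrite (le_trans c0)// ltW.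
Qed.

(** * Submartingales and thinning of the edges of the Box player *)

Definition preserving (E : S -> pred S) (u : S -> R) (s : S) : Prop :=
  match owner G s with
  | Some Box => (0 < u s -> exists y, y \in succs s /\ E s y) /\
      forall y, y \in succs s -> E s y -> u s <= u y
  | Some Diamond => forall y, y \in succs s -> u s <= u y
  | None => u s <= \sum_(y <- succs s) prob G s y * u y
  end.

(* With [v := val 1 E D], moving for n steps and then securing [a * u] shows
   [v >= a * u + (1 - a) * v_n]; in the limit, [a * v >= a * u]. *)
Lemma preserving_le_val (a : R) E D (u : S -> R) :
  0 < a <= 1 -> (forall s, 0 <= u s <= 1) ->
  (forall s, ~ T s -> D s -> u s = 0) ->
  (forall s, ~ T s -> ~ D s -> preserving E u s) ->
  (forall s, a * u s <= val 1 E D s) ->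
  forall s, u s <= val 1 E D s.
Proof.
move=> /andP[a0 a1] u01 uD uE H s; set v := val 1 E D in H *.
have a1' : 0 <= 1 - a by rewrite subr_ge0.
have a0' := ltW a0.
have v0 t : 0 <= v t by exact: val_ge0.
have valn_le n : a * u s + (1 - a) * valn 1 E D n s <= v s.
  elim: n s => [|n IH] s; first by rewrite /= mulr0 addr0.
  have [Ts|nTs] := pselect (T s).
    rewrite /v (val_target E D unit01 Ts).
    have /andP[_ us] := u01 s; have vs := valn_le1 E D unit01 n.+1 s.
    nra.
  have [Ds|nDs] := pselect (D s).
    by rewrite uD// mulr0 add0r /= memNset// mem_set// mulr0.
  rewrite /v (val_step E unit01 nTs nDs) -/v [valn _ _ _ _ _]/= !memNset// !mul1r.
  have := uE s nTs nDs; rewrite /preserving /opt; case os: (owner G s) => [[]|].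
  - move=> [Ene uy].
    have [[y0 [y0s y0E]]|nE] := pselect (exists y, y \in succs s /\ E s y).
      have [y [ys yE <-]] := bigmax_attained (valn_ge0 E D unit01 n) y0s y0E.
      apply: (@le_trans _ _ (v y)); last exact: le_bigmax_seq.
      by apply: le_trans (IH y); rewrite lerD2r ler_wpM2l ?uy.
    (* A Box state without edges has value 0 by default, and [preserving] then forces [u] to
       vanish. *)
    have -> : u s = 0.
      have /andP[us0 _] := u01 s; apply/eqP; rewrite eq_le us0 andbT leNgt.
      by apply/negP => /Ene.
    rewrite mulr0 add0r big_seq_cond big_pred0 ?mulr0 ?bigmax_ge_id// => y.
    by apply/negP => /andP[ys yE]; apply: nE; exists y.
  - move=> uy; rewrite [leRHS]big_seq; apply: le_bigmin => [|y ys].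
      have /andP[_ us] := u01 s.
      have : \big[Num.min/1]_(y <- succs s) valn 1 E D n y <= 1.
        exact: bigmin_le_id.
      by nra.
    apply: le_trans (IH y); apply: lerD; first by rewrite ler_wpM2l ?uy.
    by rewrite ler_wpM2l//; exact: ge_bigmin_seq.
  - move=> us; have [p0 _ _] := probP os.
    apply: le_trans (_ : _ <= \sum_(y <- succs s)
        prob G s y * (a * u y + (1 - a) * valn 1 E D n y)) _.
      apply: le_trans (lerD (ler_wpM2l (ltW a0) us) (lexx _)) _.
      rewrite !mulr_sumr -big_split/= le_eqVlt; apply/orP; left; apply/eqP.
      by apply: eq_bigr => y _; ring.
    by apply: ler_sum => y _; rewrite ler_wpM2l.
rewrite leNgt; apply/negP => vu.
(* For a stage within [e] of the limit, [valn_le] would give [e <= (1 - a) * e]. *)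
pose e := a * (u s - v s).
have e0 : 0 < e by rewrite mulr_gt0// subr_gt0.
have [n Hn] : exists n, v s - e < valn 1 E D n s.
  by apply: val_gt; rewrite gtrBl.
have := valn_le n.
have : (1 - a) * (v s - e) <= (1 - a) * valn 1 E D n s.
  by rewrite ler_wpM2l// ltW.
rewrite /e in e0 *; nra.
Qed.

(** The second clause keeps a Box state from losing its last edge, so that after any later thinning
    one of the edges retained so far is still available. *)
Definition thins (D : set S) (E E' : S -> pred S) : Prop :=
  (forall s y, E' s y -> E s y) /\
  (forall s y, owner G s = Some Box -> ~ T s -> ~ D s ->
    y \in succs s -> E s y -> exists z, z \in succs s /\ E' s z).

Lemma thins_refl D E : thins D E E.
Proof. by split => // s y _ _ _ ys yE; exists y. Qed.

Lemma thins_trans D E2 E1 E3 : thins D E1 E2 -> thins D E2 E3 -> thins D E1 E3.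
Proof.
move=> [s12 n12] [s23 n23]; split=> [s y /s23/s12//|s y os nT nD ys yE].
by have [z [zs zE]] := n12 s y os nT nD ys yE; exact: n23 zE.
Qed.

(** [preserving] constrains all edges of [E] and not just a best one, and therefore survives the
    removal of edges. *)
Lemma thins_preserving D E E' u : thins D E E' ->
  (forall s, ~ T s -> ~ D s -> preserving E u s) ->
  forall s, ~ T s -> ~ D s -> preserving E' u s.
Proof.
move=> [sub ne] H s nT nD; have := H s nT nD; have := ne s.
rewrite /preserving; case: (owner G s) => [[]|] // K.
move=> [H1 H2]; split=> [us|y ys /sub]; last exact: H2.
by have [y [ys yE]] := H1 us; exact: K yE.
Qed.

(* The edges of [E'] maximize a discounted value at the states where that value
   exceeds a small [e], and are those of [E] elsewhere. As [val 1 E' D] exceeds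
   [e] at the former states, it is everywhere at least [e * val 1 E D]. *)
Lemma thin_secure E D (u : S -> R) s :
  (forall s, 0 <= u s <= 1) ->
  (forall s, ~ T s -> D s -> u s = 0) ->
  (forall s, ~ T s -> ~ D s -> preserving E u s) ->
  (forall s, u s <= val 1 E D s) ->
  exists E' : S -> pred S, [/\ thins D E E',
    forall s, u s <= val 1 E' D s &
    forall E'', thins D E' E'' -> u s / 2 <= val 1 E'' D s].
Proof.
move=> u01 uD uE uv.
have [us|us] := leP (u s) 0.
  exists E; split=> //; first exact: thins_refl.
  by move=> E'' _; apply: le_trans (val_ge0 E'' D unit01 s); lra.
have us1 : u s <= 1 by case/andP: (u01 s).
(* With [w s] above [3/4] of [u s] and [e = u s / 4], the difference [w s - e] exceeds [u s / 2]. *)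
have [lam [lam01 lam_s]] : exists lam, 0 <= lam < 1 /\ u s * (3 / 4) < val lam E D s.
  by apply: discounted_approx; [lra|have := uv s; lra].
have lam01' : 0 <= lam <= 1 by move: lam01 => /andP[-> /ltW].
pose w := val lam E D; pose e := u s / 4.
have e0 : 0 < e by rewrite /e; lra.
have e0' := ltW e0.
pose E' t : pred S := fun y => E t y && ((e < w t) ==> (w t <= lam * w y)).
have E'ne t y : owner G t = Some Box -> ~ T t -> ~ D t -> y \in succs t -> E t y ->
    exists z, [/\ z \in succs t, E' t z & w t <= lam * w z].
  move=> ot nT nD ys yE; have := val_step E lam01' nT nD; rewrite -/w /opt ot => wt.
  have [z [zs zE wz]] := bigmax_attained (val_ge0 E D lam01') ys yE.
  have wz' : w t <= lam * w z by rewrite wt -wz.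
  by exists z; split=> //; rewrite /E' zE wz' implybT.
have E'E : thins D E E'.
  split=> [t y /andP[]//|t y ot nT nD ys yE].
  by have [z [zs zE _]] := E'ne t y ot nT nD ys yE; exists z.
have Ene t : owner G t = Some Box -> ~ T t -> ~ D t -> 0 < w t ->
    exists y, y \in succs t /\ E t y.
  move=> ot nT nD wt; have := val_step E lam01' nT nD; rewrite -/w => wE.
  have : 0 < opt E w t.
    rewrite lt_neqAle opt_ge0 ?andbT; last exact: val_ge0.
    by apply: contraTN wt => /eqP; rewrite wE => <-; rewrite mulr0 ltxx.
  move/(@opt_secures E w t _) => /(_ (lexx _)); rewrite /secures ot.
  by move=> [y [ys yE _]]; exists y.
have wE' t : w t <= val 1 E' D t.
  rewrite -[w t]subr0; apply: (discounted_le_val lam01) => // r orr nT nD wr.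
  by have [y [ys yE]] := Ene r orr nT nD wr; exact: E'ne yE.
have eE' n t : e * valn 1 E D n t <= val 1 E' D t.
  elim: n t => [|n IH] t; first by rewrite mulr0 val_ge0.
  have [we|we] := leP (w t) e; last first.
    apply: le_trans (wE' t); apply: le_trans (ltW we).
    by rewrite ler_piMr// valn_le1.
  have [Tt|nT] := pselect (T t).
    rewrite (val_target _ _ unit01 Tt) mulr_ile1 ?valn_ge0 ?valn_le1//.
    by rewrite /e; lra.
  have [Dt|nD] := pselect (D t).
    by rewrite /= memNset// mem_set// mulr0 val_ge0.
  rewrite (val_step _ unit01 nT nD) /= !memNset// !mul1r.
  (* No edge has been removed at [t], because [w t <= e]. *)
  have -> : opt E' (val 1 E' D) t = opt E (val 1 E' D) t.
    rewrite /opt; case: (owner G t) => [[]|] //; apply: eq_bigl => y.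
    by rewrite /E' ltNge we andbT.
  apply: le_trans (opt_scale _ _ _ _) _.
  - by rewrite e0' /e; lra.
  - by move=> y; exact: valn_ge0.
  - by apply: le_opt => y _; exact: IH.
exists E'; split=> //.
  (* The fraction [e] of [u] is secured everywhere in [E'], hence [u] itself. *)
  apply: (preserving_le_val (a := e) _ u01 uD (thins_preserving E'E uE)).
    by rewrite e0 /e; lra.
  move=> t; apply: le_trans (_ : _ <= e * val 1 E D t) _.
    by rewrite ler_wpM2l.
  rewrite -ler_pdivlMl//; apply: val_le => n.
  by rewrite ler_pdivlMl.
(* Whatever is thinned later, each edge that remains where [w] exceeds [e] is optimal for the
   discounted value. *)
move=> E'' [E''E' E''ne]; apply: le_trans (_ : _ <= w s - e) _.
  by rewrite /e /w; lra.
apply: (discounted_le_val lam01) => // t ot nT nD wt.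
have [y [ys yE]] := Ene t ot nT nD (le_lt_trans e0' wt).
have [z [zs zE _]] := E'ne t y ot nT nD ys yE.
have [x [xs xE]] := E''ne t z ot nT nD zs zE.
exists x; split=> //.
by have := E''E' _ _ xE; rewrite /E' => /andP[_]; rewrite wt.
Qed.

(* Thinning the edges successively for every state of the countable set [S]
   yields a positional choice that secures half of [u] everywhere, and hence
   [u] itself by [preserving_le_val]. *)
Lemma positional_secure E D (u : S -> R) :
  (forall s, 0 <= u s <= 1) ->
  (forall s, ~ T s -> D s -> u s = 0) ->
  (forall s, ~ T s -> ~ D s -> preserving E u s) ->
  (forall s, u s <= val 1 E D s) ->
  exists (f : S -> S) (E' : S -> pred S), [/\ forall s, f s \in succs s,
    forall s y, E' s y -> y = f s & forall s, u s <= val 1 E' D s].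
Proof.
move=> u01 uD uE uv.
pose Q F := thins D E F /\ forall s, u s <= val 1 F D s.
(* [next (n, F)] thins [F] for the state with code [n], if there is one. *)
have /choice[next nextP] (p : nat * (S -> pred S)) : exists F, Q p.2 ->
    [/\ thins D p.2 F, Q F & forall s, unpickle p.1 = Some s ->
      forall F', thins D F F' -> u s / 2 <= val 1 F' D s].
  case: p => n F /=; have [QF|nQ] := pselect (Q F); last by exists F.
  case sn : (unpickle n) => [s|]; last first.
    by exists F => _; split=> //; exact: thins_refl.
  have [F' [FF' uF' sF']] :=
    thin_secure s u01 uD (thins_preserving QF.1 uE) QF.2.
  exists F' => _; split=> //; last by move=> _ [<-].
  by split=> //; exact: thins_trans QF.1 FF'.
pose fix F n := if n is m.+1 then next (m, F m) else E.
have QF n : Q (F n).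
  by elim: n => [|n /(nextP (n, _))[]//]; split=> //; exact: thins_refl.
have FS n : thins D (F n) (F n.+1) by have [] := nextP (n, F n) (QF n).
have Fle m n : (m <= n)%N -> thins D (F m) (F n).
  move=> /subnK <-; elim: (n - m)%N => [|k IH]; first exact: thins_refl.
  by rewrite addSn; exact: thins_trans IH (FS _).
(* The edge sets decrease and are nonempty at [s], so by finite branching some edge lies in all of
   them. *)
have Fne s y : owner G s = Some Box -> ~ T s -> ~ D s -> y \in succs s ->
    E s y -> exists z, z \in succs s /\ forall n, F n s z.
  move=> os nT nD ys yE; apply: contrapT => nz.
  have [n nF] : exists n, forall z, z \in succs s -> ~ F n s z.
    have : forall z, z \in succs s -> exists n, ~ F n s z.
      by move=> z zs; apply/existsNP => zF; apply: nz; exists z.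
    elim: (succs s) => [|z r IH] H; first by exists 0%N.
    have [m Hm] := H z (mem_head _ _).
    have [|k Hk] := IH; first by move=> x xr; apply: H; rewrite inE xr orbT.
    exists (maxn m k) => x; rewrite inE => /orP[/eqP ->|xr] xF.
      by apply: Hm; exact: (Fle m _ (leq_maxl m k)).1 xF.
    by apply: (Hk x xr); exact: (Fle k _ (leq_maxr m k)).1 xF.
  by have [z [zs zF]] := (QF n).1.2 s y os nT nD ys yE; exact: nF zs zF.
have /choice[f fP] s : exists z, z \in succs s /\
    forall y, owner G s = Some Box -> ~ T s -> ~ D s -> y \in succs s -> E s y ->
      forall n, F n s z.
  have [[z zP]|nz] := pselect (exists z, z \in succs s /\ forall n, F n s z).
    by exists z; split=> [|y _ _ _ _ _]; case: zP.
  have [z zs] := has_succs s; exists z; split=> // y os nT nD ys yE.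
  by case: nz; exact: Fne yE.
pose E' s : pred S := fun y => (y == f s) && `[< forall n, F n s y >].
have FE' n : thins D (F n) E'.
  split=> [s y /andP[_ /asboolP]//|s y os nT nD ys yF].
  have yE : E s y by exact: (QF n).1.1 yF.
  have [fs fF] := fP s; exists (f s); split=> //.
  by rewrite /E' eqxx; apply/asboolP; exact: fF yE.
exists f, E'; split=> [s|s y /andP[/eqP]//|]; first by case: (fP s).
apply: (preserving_le_val (a := 2^-1) _ u01 uD (thins_preserving (FE' 0%N) uE)).
  by lra.
move=> s; rewrite mulrC.
(* The state [s] is treated at stage [pickle s], and [E'] thins the edge set that results from
   it. *)
have [_ _ /(_ s)] := nextP (pickle s, F (pickle s)) (QF _).
by rewrite pickleK => /(_ erefl); apply; exact: FE' (pickle s).+1.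
Qed.

End ValueIteration.

(** * Strategies and the reachability probability computed step by step *)

Section Strategies.
Context (R : realType) (S : countType) (G : game R S) (T : set S).
Context (fb : finitely_branching G).

Let unit01 : 0 <= (1 : R) <= 1. Proof. by rewrite ler01 lexx. Qed.

Lemma is_distr_dirac s z : succ G s z ->
  is_distr (succ G s) (fun y => (y == z)%:R : R).
Proof.
move=> sz; split=> [t|t nt|]; first by rewrite ler0n.
  by case: eqP => // tz; case: nt; rewrite tz.
rewrite esum_fset//.
rewrite fsbig_finite//= sumEFin; congr _%:E.
have zs : z \in succs G s by apply/mem_succs.
rewrite (bigD1_seq z) ?finmap.fset_uniq//= eqxx big1 ?addr0// => y.
by case: eqP.
Qed.

Section MD.
Context (p : player) (f : S -> S) (fS : forall s, f s \in succs G s).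

Definition positional : strategy G p :=
  @Strategy R S G p (fun _ s y => (y == f s)%:R)
    (fun _ s _ => is_distr_dirac ((mem_succs fb s (f s)).1 (fS s))).

Lemma positionalE w s : positional w s (f s) = 1.
Proof. by rewrite /= eqxx. Qed.

Lemma is_MD_positional : is_MD positional.
Proof. by exists f => w s _; exact: positionalE. Qed.

End MD.

Lemma distr_point s (f : S -> R) z y : is_distr (succ G s) f ->
  z \in succs G s -> f z = 1 -> y \in succs G s -> 0 < f y -> y = z.
Proof.
move=> fD zs fz ys fy; have [f0 _ _] := fD.
apply: contrapT => /eqP yz; have := distr_sum fb fD.
rewrite (bigD1_seq z) ?finmap.fset_uniq//= fz.
rewrite -big_filter (bigD1_seq y) ?filter_uniq ?finmap.fset_uniq//=; last first.
  by rewrite mem_filter yz.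
set r := \sum_(i <- _ | _) _; have : 0 <= r by exact: sumr_ge0.
lra.
Qed.

Section Reach.
Context (sigma : strategy G Box) (pi : strategy G Diamond).

Lemma tau_distr w s : is_distr (succ G s) (tau sigma pi w s).
Proof.
rewrite /tau; case os: (owner G s) => [[]|]; last exact: probP.
  exact: stratP.
exact: stratP.
Qed.

Lemma tau_ge0 w s y : 0 <= tau sigma pi w s y.
Proof. by have [] := tau_distr w s. Qed.

Lemma tau_avg_le w s (x : S -> R) c :
  (forall y, y \in succs G s -> 0 < tau sigma pi w s y -> x y <= c) ->
  \sum_(y <- succs G s) tau sigma pi w s y * x y <= c.
Proof.
move=> H; rewrite -[c]mul1r -(distr_sum fb (tau_distr w s)) mulr_suml !big_seq.
apply: ler_sum => y ys.
have := tau_ge0 w s y; rewrite le_eqVlt => /orP[/eqP <-|t0].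
  by rewrite !mul0r.
by rewrite ler_wpM2l ?tau_ge0// H.
Qed.

Lemma tau_avg_ge w s (x : S -> R) c :
  (forall y, y \in succs G s -> 0 < tau sigma pi w s y -> c <= x y) ->
  c <= \sum_(y <- succs G s) tau sigma pi w s y * x y.
Proof.
move=> H; rewrite -lerN2 -sumrN.
under eq_bigr do rewrite -mulrN.
by apply: tau_avg_le => y ys ty; rewrite lerN2 H.
Qed.

(* The probability of visiting [T] within the next [n] states, the first of
   which is [s], after the history [w]. *)
Fixpoint reachn (n : nat) (w : seq S) (s : S) : R :=
  if n is m.+1 then
    if s \in T then 1
    else \sum_(y <- succs G s) tau sigma pi w s y * reachn m (rcons w s) y
  else 0.

Definition reach (w : seq S) (s : S) : R := sup (range (fun n => reachn n w s)).

Lemma reachn_ge0 n w s : 0 <= reachn n w s.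
Proof.
elim: n w s => //= n IH w s; case: ifP => // _.
by apply: sumr_ge0 => y _; rewrite mulr_ge0 ?tau_ge0.
Qed.

Lemma reachn_le1 n w s : reachn n w s <= 1.
Proof.
elim: n w s => //= n IH w s; case: ifP => // _.
by apply: tau_avg_le => y _ _; exact: IH.
Qed.

Lemma reachn_nd w s : {homo (fun n => reachn n w s) : m n / (m <= n)%N >-> m <= n}.
Proof.
apply: homo_leq => // [? ? ?|n]; first exact: le_trans.
elim: n w s => [w s|n IH w s]; first exact: reachn_ge0.
rewrite /=; case: ifP => // _; apply: ler_sum => y _.
by rewrite ler_wpM2l ?tau_ge0//; exact: IH.
Qed.

Let has_sup_reachn w s : has_sup (range (fun n => reachn n w s)).
Proof.
split; first by exists (reachn 0 w s), 0%N.
by exists 1 => _ [n _ <-]; exact: reachn_le1.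
Qed.

Lemma reachn_le_reach n w s : reachn n w s <= reach w s.
Proof. by apply: sup_upper_bound => //; exists n. Qed.

Lemma reach_le w s c : (forall n, reachn n w s <= c) -> reach w s <= c.
Proof.
move=> H; apply: ge_sup; first by exists (reachn 0 w s), 0%N.
by move=> _ [n _ <-].
Qed.

Lemma reach_ge0 w s : 0 <= reach w s.
Proof. exact: le_trans (reachn_ge0 0 w s) (reachn_le_reach 0 w s). Qed.

Lemma reach_target w s : T s -> 1 <= reach w s.
Proof.
by move=> Ts; apply: le_trans (reachn_le_reach 1 w s); rewrite /= mem_set.
Qed.

Lemma reach_step w s : ~ T s ->
  reach w s <= \sum_(y <- succs G s) tau sigma pi w s y * reach (rcons w s) y.
Proof.
move=> nT; apply: reach_le => -[|n] /=.
  by apply: sumr_ge0 => y _; rewrite mulr_ge0 ?tau_ge0 ?reach_ge0.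
rewrite memNset//; apply: ler_sum => y _.
by rewrite ler_wpM2l ?tau_ge0 ?reachn_le_reach.
Qed.

Lemma reach_le_supermartingale (g : S -> R) :
  (forall s, 0 <= g s) -> (forall s, T s -> g s = 1) ->
  (forall w s, ~ T s -> \sum_(y <- succs G s) tau sigma pi w s y * g y <= g s) ->
  forall w s, reach w s <= g s.
Proof.
move=> g0 gT gS w s; apply: reach_le => n.
elim: n w s => [w s|n IH w s] /=; first exact: g0.
case: ifPn => [/set_mem/gT ->//|/negP nT].
have nTs : ~ T s by move=> ?; apply: nT; rewrite inE.
apply: le_trans (gS w s nTs); apply: ler_sum => y _.
by rewrite ler_wpM2l ?tau_ge0.
Qed.

(** The only edge that [E] can offer at [s] is [f s], so playing [f] does at least as well; where
    [E] offers none, the maximum takes its default 0. *)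
Lemma val_le_reach (f : S -> S) (E : S -> pred S) D w s :
  (forall s, f s \in succs G s) -> (forall s y, E s y -> y = f s) ->
  (forall w s, owner G s = Some Box -> sigma w s (f s) = 1) ->
  val G T 1 E D s <= reach w s.
Proof.
move=> fS Ef sf; apply: val_le => n; apply: le_trans (reachn_le_reach n w s).
elim: n w s => //= n IH w s; case: ifP => // _; case: ifP => [_|_].
  by apply: sumr_ge0 => y _; rewrite mulr_ge0 ?tau_ge0 ?reachn_ge0.
rewrite mul1r /opt; case os: (owner G s) => [[]|].
- apply: tau_avg_ge => y ys ty.
  have yf : y = f s.
    by apply: distr_point (tau_distr w s) _ _ ys ty; rewrite ?fS// /tau os sf.
  rewrite yf big_seq_cond; apply: bigmax_le => [|z /andP[_ /Ef ->]].
    exact: reachn_ge0.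
  exact: IH.
- apply: tau_avg_ge => y ys _; apply: le_trans (IH (rcons w s) y).
  exact: ge_bigmin_seq.
- rewrite /tau os; have [p0 _ _] := probP os; apply: ler_sum => y _.
  by rewrite ler_wpM2l.
Qed.

End Reach.

Definition plays_by (p : player) (tau : strategy G p) (f : S -> S) : Prop :=
  forall w s, owner G s = Some p -> tau w s (f s) = 1.

Lemma positional_plays_by p (f : S -> S) (fS : forall s, f s \in succs G s) :
  plays_by (positional p fS) f.
Proof. by move=> w s _; exact: positionalE. Qed.

Lemma exists_argmin (u : S -> R) s :
  exists y, y \in succs G s /\ forall z, z \in succs G s -> u y <= u z.
Proof.
have [y0 y0s] := has_succs fb s.
suff H (r : seq S) : y0 \in r -> exists y, y \in r /\ forall z, z \in r -> u y <= u z.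
  exact: H.
elim: r y0 {y0s} => // x r IH y0 _.
case: r IH => [|x' r] IH.
  by exists x; split=> [|z]; rewrite inE // => /eqP ->.
have [y [yr ymin]] := IH x' (mem_head _ _).
have [xy|yx] := leP (u x) (u y).
  exists x; split=> [|z]; first exact: mem_head.
  by rewrite inE => /orP[/eqP -> //|/ymin]; exact: le_trans.
exists y; split=> [|z]; first by rewrite inE yr orbT.
by rewrite inE => /orP[/eqP ->|/ymin //]; exact: ltW.
Qed.

(** * A bound [g] that no move increases in expectation *)

Section Confined.
Context (g : S -> R) (g01 : forall s, 0 <= g s <= 1).
Context (gT : forall s, T s -> g s = 1).
Context (gP : forall s p y, owner G s = Some p -> y \in succs G s -> g y <= g s).
Context (g_avg : forall s, owner G s = None ->
  \sum_(y <- succs G s) prob G s y * g y <= g s).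

Let g_tau (sigma : strategy G Box) (pi : strategy G Diamond) w s :
  \sum_(y <- succs G s) tau sigma pi w s y * g y <= g s.
Proof.
case os : (owner G s) => [p|]; last by rewrite /tau os; exact: g_avg.
by apply: tau_avg_le => y ys _; exact: gP os ys.
Qed.

Lemma reach_le_confined (sigma : strategy G Box) (pi : strategy G Diamond) w s :
  reach sigma pi w s <= g s.
Proof.
apply: reach_le_supermartingale => // t; by case/andP: (g01 t).
Qed.

Lemma val_le_confined E D s : val G T 1 E D s <= g s.
Proof.
apply: val_le => n; elim: n s => [|n IH] s /=; first by case/andP: (g01 s).
case: ifPn => [/set_mem/gT ->//|_]; case: ifP => [_|_].
  by case/andP: (g01 s).
rewrite mul1r; apply: le_trans (le_opt fb E (fun y _ => IH y)) _.
rewrite /opt; case os: (owner G s) => [[]|]; last exact: g_avg.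
  rewrite big_seq_cond; apply: bigmax_le; first by case/andP: (g01 s).
  by move=> y /andP[ys _]; exact: gP os ys.
have [y ys] := has_succs fb s.
by apply: le_trans (gP os ys); exact: ge_bigmin_seq.
Qed.

(** Both [reach <= g] and the decrease of [g] are inequalities between averages. If [g] is attained
    at [s], no successor of positive probability leaves any slack in them. *)
Lemma reach_tight_step (sigma : strategy G Box) (pi : strategy G Diamond) w s y :
  ~ T s ->
  g s <= reach sigma pi w s -> y \in succs G s -> 0 < tau sigma pi w s y ->
  g y <= reach sigma pi (rcons w s) y /\ (owner G s = Some Box -> g y = g s).
Proof.
move=> nT gs ys ty; set t := tau sigma pi w s in ty *.
have t0 z : 0 <= t z by exact: tau_ge0.
have gr := le_trans gs (reach_step sigma pi w nT).
have tD := distr_sum fb (tau_distr sigma pi w s).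
have zero (x : S -> R) : (forall z, z \in succs G s -> 0 <= x z) ->
    \sum_(z <- succs G s) t z * x z <= 0 -> x y <= 0.
  move=> x0 xs; rewrite leNgt; apply/negP => xy; move: xs; apply/negP.
  rewrite -ltNge (bigD1_seq y) ?finmap.fset_uniq//=.
  apply: ltr_pwDl; first exact: mulr_gt0.
  by rewrite big_seq_cond; apply: sumr_ge0 => z /andP[zs _]; rewrite mulr_ge0 ?x0.
split=> [|os].
  rewrite -subr_le0.
  apply: (zero (fun y => g y - reach sigma pi (rcons w s) y)).
    by move=> z _; rewrite subr_ge0 reach_le_confined.
  under eq_bigr do rewrite mulrBr; rewrite sumrB subr_le0.
  exact: le_trans (g_tau _ _ _ _) gr.
apply/eqP; rewrite eq_le (gP os ys)/= -subr_le0.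
apply: (zero (fun y => g s - g y)) => [z zs|].
  by rewrite subr_ge0 (gP os zs).
under eq_bigr do rewrite mulrBr; rewrite sumrB -mulr_suml tD mul1r subr_le0.
apply: le_trans gr _; apply: ler_sum => z _.
by rewrite ler_wpM2l ?reach_le_confined.
Qed.

(* [A] is a maximal partial choice for the Diamond player that keeps the
   probability of reaching [T] below [g] on its domain [D]. Outside of [D], the
   value [u] of the game in which [D] is losing for the Box player and the edges
   along which [g] decreases are removed must be [g], since minimizing [u] would
   otherwise extend [A]. *)
Lemma confined_MD : exists f h : S -> S,
  [/\ forall s, f s \in succs G s, forall s, h s \in succs G s &
   forall s, (forall (sigma : strategy G Box) (pi : strategy G Diamond) w,
                plays_by sigma f -> g s <= reach sigma pi w s) \/
             (forall (sigma : strategy G Box) (pi : strategy G Diamond) w,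
                plays_by pi h -> reach sigma pi w s < g s)].
Proof.
(* Partial choices are sets of pairs, so that chains have unions for Zorn's lemma. The last clause
   of [P] quantifies over all strategies that agree with [A] and thus persists when [A] grows. *)
pose agrees (pi : strategy G Diamond) (A : set (S * S)) :=
  forall t z w, A (t, z) -> owner G t = Some Diamond -> pi w t z = 1.
pose P (A : set (S * S)) := [/\ forall s y z, A (s, y) -> A (s, z) -> y = z,
  forall s y, A (s, y) -> y \in succs G s &
  forall s y, A (s, y) -> forall sigma pi w, agrees pi A ->
    reach sigma pi w s < g s].
have [F FP Ftot|A [PA Amax]] := @Zorn_bigcup (S * S)%type P.
  split=> [s y z [X FX Xy] [Y FY Yz]|s y [X FX Xy]|s y [X FX Xy] sigma pi w pF].
  - have [XY|YX] := Ftot X Y FX FY.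
      by have [funY _ _] := FP Y FY; exact: funY (XY _ Xy) Yz.
    by have [funX _ _] := FP X FX; exact: funX Xy (YX _ Yz).
  - by have [_ XS _] := FP X FX; exact: XS Xy.
  - have [_ _ XP] := FP X FX; apply: XP Xy _ _ _ _ => t z v Xtz.
    by apply: pF; exists X.
have [funA AS AP] := PA.
pose D s := exists y, A (s, y).
have /choice[h hP] s : exists y, y \in succs G s /\ forall z, A (s, z) -> z = y.
  have [[y Ay]|nA] := pselect (D s).
    by exists y; split=> [|z Az]; [exact: AS Ay|exact: funA Az Ay].
  have [y ys] := has_succs fb s; exists y; split=> // z Az.
  by case: nA; exists z.
have hS s : h s \in succs G s by case: (hP s).
have agrees_h (pi : strategy G Diamond) : plays_by pi h -> agrees pi A.
  by move=> ph t z w /(hP t).2 -> /ph.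
have DT s : D s -> ~ T s.
  move=> [y Ay] Ts.
  have := AP s y Ay (positional Box hS) (positional Diamond hS) [::].
  move=> /(_ (agrees_h _ (positional_plays_by hS))).
  by rewrite gT// ltNge reach_target.
pose E s : pred S := fun y => `[< ~ D y >] && (g y == g s).
pose u := val G T 1 E D.
have u_le_g s : u s <= g s by exact: val_le_confined.
have u1 s : u s <= 1 by exact: val_le1.
have u0 s : 0 <= u s by exact: val_ge0.
have g_le_u s : ~ D s -> g s <= u s.
  move=> nDs; rewrite leNgt; apply/negP => us.
  have /choice[m mP] := exists_argmin u.
  (* The extension by a minimizer [m] of [u] at all states outside of [D] where [u] is below [g]
     contradicts maximality. *)
  pose B := A `|` [set p | [/\ ~ D p.1, u p.1 < g p.1 & p.2 = m p.1]].
  apply: (Amax B).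
    split; first by move=> p Ap; left.
    move=> /(_ (s, m s)) BA; apply: (nDs); exists (m s); apply: BA.
    by right; split=> //=.
  split.
  - move=> t y z [Ay|[/= nDt _ ->]] [Az|[/= nDt' _ ->]] //.
    + exact: funA Ay Az.
    + by case: nDt'; exists y.
    + by case: nDt; exists z.
  - move=> t y [/AS//|[/= _ _ ->]]; by case: (mP t).
  - move=> t y Bty sigma pi w piB.
    have piA : agrees pi A by move=> t' z' w' Az'; apply: piB; left.
    have [[z Az]|nDt] := pselect (D t); first exact: AP Az _ _ _ piA.
    have ut : u t < g t by case: Bty => [Aty|[]//]; case: nDt; exists y.
    rewrite ltNge; apply/negP => gt.
    (* If [g] is attained at [r], then by [reach_tight_step] it is attained at every successor of
       positive probability. The play thus avoids [D], Box moves use edges of [E], and Diamond moves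
       minimize [u] wherever [u] is below [g]. Hence [u] bounds the probability, although
       [u t < g t]. *)
    suff H n v r : g r <= reach sigma pi v r -> reachn sigma pi n v r <= u r.
      by have := reach_le (fun n => H n w t gt); rewrite leNgt (lt_le_trans ut).
    elim: n v r => [|n IH] v r gr; first exact: u0.
    have [Tr|nT] := pselect (T r).
      by rewrite /u (val_target fb _ _ unit01 Tr) reachn_le1.
    have notD v' r' : g r' <= reach sigma pi v' r' -> ~ D r'.
      by move=> gr' [z Az]; move: gr'; rewrite leNgt (AP _ _ Az).
    have nDr := notD v r gr.
    have [gu|ug] := leP (g r) (u r).
      apply: le_trans gu; apply: le_trans (reachn_le_reach sigma pi n.+1 v r) _.
      exact: reach_le_confined.
    have := val_step fb E unit01 nT nDr; rewrite -/u mul1r => ->.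
    rewrite /= memNset//.
    have tight z zs tz := reach_tight_step (y := z) nT gr zs tz.
    rewrite /opt; case orr : (owner G r) => [[]|].
    + apply: tau_avg_le => // z zs tz; have [gz gzr] := tight z zs tz.
      apply: le_trans (IH _ _ gz) _; apply: le_bigmax_seq => //.
      rewrite /E gzr// eqxx andbT; apply/asboolP; exact: notD gz.
    + have [mr mmin] := mP r.
      have pim : pi v r (m r) = 1 by apply: piB orr; right; split=> //=.
      apply: tau_avg_le => // z zs tz; have [gz _] := tight z zs tz.
      have zm : z = m r.
        apply: distr_point (tau_distr sigma pi v r) mr _ zs tz.
        by rewrite /tau orr.
      apply: le_trans (IH _ _ gz) _.
      rewrite big_seq; apply: le_bigmin => // y' ys'; rewrite zm; exact: mmin.
    + have tE : tau sigma pi v r = prob G r by rewrite /tau orr.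
      rewrite tE !big_seq; apply: ler_sum => z zs.
      have := tau_ge0 sigma pi v r z; rewrite tE le_eqVlt => /orP[/eqP <-|tz].
        by rewrite !mul0r.
      rewrite ler_wpM2l ?(ltW tz)//; apply: IH.
      by have [] := tight z zs; rewrite ?tE.
have ug s : ~ D s -> u s = g s.
  by move=> nD; apply/eqP; rewrite eq_le u_le_g g_le_u.
(* Edges of [E] avoid [D] and keep [g] constant, so they preserve [u], which equals [g] outside of
   [D]. *)
have [||||f [E' [fS E'f uE']]] := @positional_secure R S G T fb E D u.
- by move=> s; rewrite u0 u1.
- by move=> s nT Ds; exact: val_dead.
- move=> s nT nD; have := val_step fb E unit01 nT nD; rewrite -/u mul1r => us.
  rewrite /preserving; case os : (owner G s) => [[]|].
  + split=> [us0|y ys /andP[/asboolP nDy /eqP gys]].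
      move: us0; rewrite us => us0.
      have := opt_secures us0 (lexx _); rewrite /secures os.
      by move=> [y [ys yE _]]; exists y.
    by rewrite !ug// gys.
  + by move=> y ys; rewrite us /opt os; exact: ge_bigmin_seq.
  + by rewrite {1}us /opt os.
- by [].
exists f, h; split=> // s.
have [[y Ay]|nD] := pselect (D s); [right|left] => sigma pi w.
  by move=> /agrees_h; exact: AP Ay _ _ _.
move=> sf; rewrite -ug//; apply: le_trans (uE' s) _.
exact: val_le_reach fS E'f sf.
Qed.

End Confined.
End Strategies.

(** * Sampling by inverting a distribution function *)

Section InverseCDF.
Context (R : realFieldType) (I : eqType).

(* Given [v] uniform on [0, 1[, the first component has law [p], and
   conditionally on it the second component is again uniform on [0, 1[. *)
Fixpoint pick (p : I -> R) (r : seq I) (d : I) (v : R) : I * R :=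
  if r is y :: r' then
    if v < p y then (y, v / p y) else pick p r' d (v - p y)
  else (d, v).

(** For [y] in [r], the offset [b] is the mass of the entries before [y]; otherwise the interval is
    empty. The default [d] is never returned, as [v] lies below the total mass. *)
Lemma pickP (p : I -> R) (r : seq I) (d y : I) :
  uniq r -> (forall z, 0 <= p z) ->
  let q := if y \in r then p y else 0 in
  exists b, [/\ 0 <= b, b + q <= \sum_(z <- r) p z &
    forall v, 0 <= v < \sum_(z <- r) p z ->
      ((pick p r d v).1 = y <-> b <= v < b + q) /\
      ((pick p r d v).1 = y -> (pick p r d v).2 = (v - b) / p y)].
Proof.
move=> + p0; elim: r => [_|z r IH /= /andP[zr /IH{IH}]].
  exists 0; split=> //=; first by rewrite big_nil addr0.
  by move=> v; rewrite big_nil; lra.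
rewrite big_cons inE => -[b [b0 bq bv]].
have pz := p0 z; case: eqVneq bq bv => [->|yz] /= bq bv.
  rewrite (negPf zr) in bq bv.
  exists 0; split=> //; first by rewrite add0r lerDl sumr_ge0.
  move=> v v01; case: ifPn => [vz|zv] /=.
    by split=> [|_]; [split=> // _; lra|rewrite subr0].
  have [|H1 H2] := bv (v - p z); first by lra.
  split; last by move=> /H1; lra.
  by split=> [/H1|?]; [lra|exfalso; lra].
exists (b + p z); split; [lra|lra|move=> v v01].
case: ifPn => [vz|zv] /=.
  split; last by move=> zy; rewrite zy eqxx in yz.
  by split=> [zy|?]; [rewrite zy eqxx in yz|exfalso; lra].
have [|H1 H2] := bv (v - p z); first by lra.
split; last by move=> /H2 ->; congr (_ / _); lra.
by split=> [/H1|H]; [lra|apply/H1; lra].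
Qed.

End InverseCDF.

(** * Existence of the law of plays *)

Section Law.
Context (R : realType) (S : countType) (G : game R S) (s0 : S).
Context (fb : finitely_branching G).
Context (sigma : strategy G Box) (pi : strategy G Diamond).

(** One number [u] drives the whole play: the remainder left by each [pick] is the randomness of the
    next step. *)
Let run (u : R) : nat -> seq S * S * R :=
  fix run n := if n is m.+1 then
    let: (w, s, v) := run m in
    let: (y, v') := pick (tau sigma pi w s) (succs G s) s v in
    (rcons w s, y, v')
  else ([::], s0, u).

Definition path_prob (x : nat -> S) n : R :=
  \prod_(i < n) tau sigma pi (mkseq x i) (x i) (x i.+1).

(** Each step subdivides the interval of the current prefix in proportion to the probabilities of
    the next states, and the remainder is the relative position of [u] in its interval. *)
Let run_itv (x : nat -> S) n : x 0%N = s0 ->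
  exists a, [/\ 0 <= a, a + path_prob x n <= 1 &
    forall u, 0 <= u < 1 ->
      ((forall i, (i <= n)%N -> (run u i).1.2 = x i) <->
         a <= u < a + path_prob x n) /\
      ((forall i, (i <= n)%N -> (run u i).1.2 = x i) ->
         run u n = (mkseq x n, x n, (u - a) / path_prob x n))].
Proof.
move=> x0; elim: n => [|n [a [a0 a1 aP]]].
  exists 0; rewrite /path_prob big_ord0; split=> [//||]; rewrite ?add0r//.
  move=> u u01; split; last by rewrite subr0 divr1 /= x0.
  by split=> // _ [|//]; rewrite /= x0.
set p := path_prob x n in a1 aP.
pose t := tau sigma pi (mkseq x n) (x n).
have tD : is_distr (succ G (x n)) t by exact: tau_distr.
have t0 y : 0 <= t y by exact: tau_ge0.
have t1 := distr_sum fb tD.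
have pS : path_prob x n.+1 = p * t (x n.+1) by rewrite /path_prob big_ord_recr.
have p0 : 0 <= p by apply: prodr_ge0 => i _; exact: tau_ge0.
have [b [b0 b1 bP]] :=
  pickP (x n) (x n.+1) (finmap.fset_uniq (fset_set (succ G (x n)))) t0.
rewrite -/(succs G (x n)) t1 in b1 bP.
(* A state that is no successor has probability 0, which gives an empty interval. *)
have qE : (if x n.+1 \in succs G (x n) then t (x n.+1) else 0) = t (x n.+1).
  case: ifPn => // /negP ns; have [_ tS _] := tD; rewrite tS// => /mem_succs.
  by move=> /(_ fb).
rewrite qE in b1 bP.
have tn0 := t0 (x n.+1); set q := t (x n.+1) in pS b1 bP tn0.
have pb0 : 0 <= p * b by rewrite mulr_ge0.
have pq0 : 0 <= p * q by rewrite mulr_ge0.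
have pbq : p * (b + q) <= p by rewrite ler_piMr.
exists (a + p * b); rewrite pS; split; [lra|lra|move=> u u01].
have [aP1 aP2] := aP u u01.
have split_n : (forall i, (i <= n.+1)%N -> (run u i).1.2 = x i) <->
    (forall i, (i <= n)%N -> (run u i).1.2 = x i) /\ (run u n.+1).1.2 = x n.+1.
  split=> [H|[H1 H2] i]; first by split=> [i iN|]; apply: H => //; exact: leqW.
  by rewrite leq_eqVlt => /orP[/eqP ->//|]; rewrite ltnS; exact: H1.
set hist := forall i, (i <= n)%N -> _ in split_n aP1 aP2.
have stepE (H : hist) : let z := pick t (succs G (x n)) (x n) ((u - a) / p) in
    run u n.+1 = (mkseq x n.+1, z.1, z.2).
  have := aP2 H; rewrite /= => ->; rewrite -/t.
  by case: (pick _ _ _ _) => y v /=; rewrite mkseqS.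
have resid (H : hist) : [/\ 0 < p, 0 <= (u - a) / p < 1 & u = a + p * ((u - a) / p)].
  have /andP[au uap] := aP1.1 H.
  have pp : 0 < p by lra.
  split=> //; last by rewrite mulrC divfK ?gt_eqF// addrC subrK.
  by rewrite divr_ge0 ?subr_ge0//= ltr_pdivrMr// mul1r ltrBlDl.
split.
  apply: iff_trans split_n _; split.
    move=> [H]; rewrite (stepE H) /=; have [pp v01 uE] := resid H.
    have [bP1 _] := bP _ v01; move=> /bP1 /andP[bv vb].
    have := ler_wpM2l p0 bv; have : p * ((u - a) / p) < p * (b + q).
      by rewrite ltr_pM2l.
    by rewrite mulrDr; lra.
  move=> /andP[u1 u2].
  have H : hist by apply/aP1; move: pbq; rewrite mulrDr; lra.
  split=> //; rewrite (stepE H) /=; have [pp v01 uE] := resid H.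
  have [bP1 _] := bP _ v01; apply/bP1; set r := (u - a) / p in uE *.
  by apply/andP; split; [rewrite -(ler_pM2l pp)|rewrite -(ltr_pM2l pp) mulrDr]; lra.
move=> /split_n[H]; rewrite (stepE H) /= => zx; have [pp v01 uE] := resid H.
have [_ bP2] := bP _ v01; rewrite zx (bP2 zx); congr (_, _, _).
rewrite -/q invfM mulrA; congr (_ / _).
by field; rewrite gt_eqF.
Qed.

Let unit_itv : set R := `[0, 1[%classic.

(** Numbers outside of the unit interval will carry no mass; they are mapped to the play of 0 to
    make the function total. *)
Let play (u : R) : play_space s0 :=
  fun n => (run (if u \in unit_itv then u else 0) n).1.2.

Let play_itv x n : x 0%N = s0 -> exists a,
  [/\ 0 <= a, a + path_prob x n <= 1 &
    forall u, play u \in cylinder x n <->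
      a <= (if u \in unit_itv then u else 0) < a + path_prob x n].
Proof.
move=> /(run_itv n)[a [a0 a1 aP]]; exists a; split=> // u.
set v := if _ then _ else _.
have v01 : 0 <= v < 1.
  rewrite /v; case: ifPn => [/set_mem|_]; last by rewrite lexx ltr01.
  by rewrite /unit_itv /= in_itv.
apply: iff_trans (aP v v01).1; split=> [/set_mem H i iN|H].
  by have := H i iN; rewrite /play -/v.
by apply/mem_set => i iN; rewrite /play -/v; exact: H.
Qed.

Let measurable_unit : measurable unit_itv.
Proof. exact: measurable_itv. Qed.

Let measurable_play :
  @measurable_fun _ _ (measurableTypeR R) (play_space s0) setT play.
Proof.
apply: (@measurability _ _ _ (play_space s0) _ _ (@cylinders S s0)) => //.
move=> _ [_ [x [n ->]] <-]; rewrite setTI.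
have [x0|x0] := pselect (x 0%N = s0); last first.
  rewrite (_ : _ @^-1` _ = set0)//; apply/seteqP; split=> // u Hu.
  by apply: x0; rewrite -(Hu 0%N (leq0n _)).
have [a [a0 a1 aP]] := play_itv n x0.
set p := path_prob x n in a1 aP.
rewrite (_ : _ @^-1` _ = (unit_itv `&` `[a, (a + p)[) `|`
    (~` unit_itv `&` (if a <= 0 < a + p then setT else set0))).
  apply: measurableU; apply: measurableI => //.
  - exact: measurableC.
  - by case: ifP.
apply/seteqP; split=> u.
  move=> /mem_set/aP; case: ifPn => [/set_mem ui ua|/negP ui ua].
    by left; split=> //=; rewrite in_itv.
  by right; rewrite ua; split=> // ?; apply: ui; rewrite inE.
move=> H; apply/set_mem/aP; case: H => -[ui].
  by rewrite /= in_itv/= => ua; rewrite mem_set.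
by case: ifP => // ua _; rewrite memNset.
Qed.

(** The image under [play] of the Lebesgue measure on the unit interval: the preimage of a cylinder
    is an interval of the prescribed length. *)
Lemma exists_play_law : exists P : probability (play_space s0) R,
  is_play_law sigma pi P.
Proof.
pose mu := mrestr (@lebesgue_measure R) measurable_unit.
pose X := @mfun_Sub _ _ (measurableTypeR R) (play_space s0) play
  (mem_set measurable_play).
have muT : mu setT = 1%E.
  by rewrite /mu /mrestr setTI lebesgue_measure_itv/= lte01 sube0.
pose Q := Measure_isProbability.Build _ _ _ mu muT.
pose P0 : probability (measurableTypeR R) R := HB.pack mu Q.
exists (distribution P0 X) => x n x0.
have [a [a0 a1 aP]] := play_itv n x0.
rewrite /distribution /pushforward /= /mu /mrestr -/(path_prob x n).
rewrite (_ : _ `&` _ = `[a, (a + path_prob x n)[%classic).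
  have p0 : 0 <= path_prob x n by apply: prodr_ge0 => i _; exact: tau_ge0.
  rewrite lebesgue_measure_itv/= lte_fin; case: ltP => [_|].
    by rewrite -EFinB addrAC subrr add0r.
  by rewrite gerDl => p0'; congr _%:E; apply/eqP; rewrite eq_le p0 p0'.
apply/seteqP; split=> u /=.
  by move=> [/mem_set/aP + ui]; rewrite mem_set// in_itv.
rewrite in_itv/= => /andP[au ua].
have ui : unit_itv u by rewrite /unit_itv /= in_itv/=; lra.
by split=> //; apply/set_mem/aP; rewrite mem_set// au.
Qed.


Lemma play_lawP : is_play_law sigma pi (play_law s0 sigma pi).
Proof. exact: (getPex exists_play_law). Qed.

Let cyl x n : set (play_space s0) := cylinder x n.

Lemma measurable_cylinder x n : measurable (cyl x n).
Proof. by apply: sub_sigma_algebra; exists x, n. Qed.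

Lemma measurable_coordinate (T : set S) i :
  measurable ([set r | T (r i)] : set (play_space s0)).
Proof.
(* The event is a union of cylinders given by finite sequences [w], of which there are countably
   many. *)
rewrite (_ : [set r | _] =
    \bigcup_w (if `[< T (nth s0 w i) >] then cyl (nth s0 w) i else set0)).
  apply: countable_bigcupT_measurable => [|w]; first exact: countableP.
  by case: ifP => // _; exact: measurable_cylinder.
apply/seteqP; split=> [r Tr|r [w _]].
  have nr j : (j <= i)%N -> nth s0 (mkseq r i.+1) j = r j.
    by move=> ji; rewrite nth_mkseq.
  exists (mkseq r i.+1) => //; rewrite nr//.
  by case: asboolP => // _ j ji; rewrite nr.
by case: asboolP => // Tw /(_ i (leqnn i)) /= ->.
Qed.

Let upd (x : nat -> S) k y : nat -> S := fun i => if i == k.+1 then y else x i.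

Let mkseq_upd x k y : mkseq (upd x k y) k.+1 = mkseq x k.+1.
Proof.
apply/eq_in_map => i; rewrite mem_iota /= add0n => ik.
by rewrite /upd ltn_eqF.
Qed.

Let path_prob_upd x k y :
  path_prob (upd x k y) k.+1 = path_prob x k * tau sigma pi (mkseq x k) (x k) y.
Proof.
have E i : (i <= k)%N -> mkseq (upd x k y) i = mkseq x i.
  move=> ik; apply/eq_in_map => j; rewrite mem_iota /= add0n => ji.
  by rewrite /upd ltn_eqF// ltnS (leq_trans (ltnW ji)).
rewrite /path_prob big_ord_recr/= E//; congr (_ * _).
  apply: eq_bigr => -[i ik] _ /=; rewrite E 1?ltnW//.
  by rewrite /upd !ltn_eqF// !ltnS// ltnW.
by rewrite /upd eqxx ltn_eqF.
Qed.

Let cyl_upd x k y : cyl (upd x k y) k.+1 = cyl x k `&` [set r | r k.+1 = y].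
Proof.
apply/seteqP; split=> [r H|r [H ry] i].
  split=> [i ik|]; last by rewrite /= (H k.+1 (leqnn _)) /upd eqxx.
  by rewrite H 1?leqW// /upd ltn_eqF.
rewrite leq_eqVlt => /orP[/eqP ->|ik]; first by rewrite /upd eqxx.
by rewrite /upd ltn_eqF// H.
Qed.

(** * The probability of reaching the target under the law *)

Section PlayLaw.
Context (P : probability (play_space s0) R).
Context (lawP : is_play_law sigma pi P).

(** The cylinders of the successors already carry the whole mass of [cyl x k], since the transition
    probabilities sum to 1; the remaining plays form a null set. *)
Let split_cylinder x k (B : set (play_space s0)) : x 0%N = s0 ->
  measurable B -> B `<=` cyl x k ->
  P B = (\sum_(y <- succs G (x k)) P (B `&` cyl (upd x k y) k.+1))%E.
Proof.
move=> x0 mB Bx; pose D := succ G (x k).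
have finU (A : set (play_space s0)) : measurable A ->
    P (A `&` \bigcup_(y in D) cyl (upd x k y) k.+1) =
    (\sum_(y <- succs G (x k)) P (A `&` cyl (upd x k y) k.+1))%E.
  move=> mA; rewrite setI_bigcupr measure_fin_bigcup.
  - by rewrite fsbig_finite//; exact: fb.
  - exact: fb.
  - move=> y z _ _ [r [[_ +] [_ +]]]; rewrite !cyl_upd => -[_ /= <-] [_ /= <-].
    by [].
  - by move=> y _; apply: measurableI => //; exact: measurable_cylinder.
set M := \bigcup_(y in D) cyl (upd x k y) k.+1 in finU.
have mM : measurable M.
  apply: fin_bigcup_measurable => [|y _]; first exact: fb.
  exact: measurable_cylinder.
have PM : P (cyl x k `&` M) = P (cyl x k).
  rewrite finU; last exact: measurable_cylinder.
  rewrite lawP// -/(path_prob x k).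
  transitivity (\sum_(y <- succs G (x k))
      (path_prob x k * tau sigma pi (mkseq x k) (x k) y)%:E)%E.
    apply: eq_bigr => y _; rewrite cyl_upd setIA setIid -cyl_upd.
    by rewrite lawP -/(path_prob _ _) ?path_prob_upd// /upd.
  by rewrite sumEFin -mulr_sumr (distr_sum fb (tau_distr _ _ _ _)) mulr1.
have P0 : P (cyl x k `\` M) = 0%E.
  have mc := measurable_cylinder x k.
  have fin_c : (P (cyl x k) < +oo)%E.
    by apply: le_lt_trans (probability_le1 P mc) _; rewrite ltry.
  apply: etrans (measureD mc mM fin_c) _.
  apply: etrans (congr1 (fun z => P (cyl x k) - z)%E PM) _.
  by rewrite subee// fin_num_measure.
rewrite -finU// (measureDI P mB mM) (subset_measure0 (B := cyl x k `\` M)) ?add0e//.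
- exact: measurableD.
- by apply: measurableD => //; exact: measurable_cylinder.
- by move=> r [Br Mr]; split=> //; exact: Bx.
Qed.

Context (T : set S).

(** The window of [n] positions includes [k] itself, in step with [reachn]. *)
Let hits x k n : set (play_space s0) :=
  cyl x k `&` [set r | exists i, (k <= i < k + n)%N /\ T (r i)].

Let measurable_hits x k n : measurable (hits x k n).
Proof.
apply: measurableI; first exact: measurable_cylinder.
rewrite (_ : [set r | _] = \bigcup_(i in [set i | (k <= i < k + n)%N])
    ([set r | T (r i)] : set (play_space s0))).
  by apply: bigcup_measurable => i _; exact: measurable_coordinate.
by apply/seteqP; split=> [r [i [ik Ti]]|r [i ik Ti]]; exists i.
Qed.

Let law_hits n x k : x 0%N = s0 ->
  P (hits x k n) =
  (path_prob x k * reachn T sigma pi n (mkseq x k) (x k))%:E.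
Proof.
elim: n x k => [|n IH] x k x0 /=.
  rewrite mulr0 (_ : hits _ _ _ = set0) ?measure0//.
  by apply/seteqP; split=> // r [_ [i []]]; rewrite addn0; case: ltngtP.
case: ifPn => [/set_mem Tx|/negP nT].
  rewrite mulr1 (_ : hits _ _ _ = cyl x k); first exact: lawP.
  apply/seteqP; split=> [r []//|r rx]; split=> //.
  exists k; rewrite leqnn addnS ltnS leq_addr; split=> //.
  by rewrite (rx k (leqnn k)).
rewrite (@split_cylinder x k _ x0 (measurable_hits _ _ _)); last by move=> r [].
rewrite mulr_sumr -sumEFin; apply: eq_bigr => y _.
(* Since [x k] is not in [T], the visit takes place from position [k.+1] on. *)
have -> : hits x k n.+1 `&` cyl (upd x k y) k.+1 = hits (upd x k y) k.+1 n.
  apply/seteqP; split=> r.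
    move=> [[rx [i [/andP[ki ik] Ti]]] ry]; split=> //; exists i; split=> //.
    rewrite addSnnS ik andbT ltn_neqAle ki andbT.
    apply: contra_notN nT => /eqP ki'; rewrite inE.
    by rewrite -(rx k (leqnn k)) ki'.
  move=> [ry [i [/andP[ki ik] Ti]]]; split=> //; split.
    by move: ry; rewrite cyl_upd => -[].
  by exists i; rewrite (ltnW ki) -addSnnS.
rewrite IH; last by rewrite /upd.
by rewrite path_prob_upd mkseq_upd mkseqS /upd eqxx mulrA.
Qed.

(** Continuity from below along growing windows that start at 0. Intersecting with the plays from
    [s0] costs nothing, as they have probability 1. *)
Lemma law_Reach : P (Reach T) = (reach T sigma pi [::] s0)%:E.
Proof.
pose x : nat -> S := fun=> s0.
have Px : P (cyl x 0) = 1%E by rewrite lawP// big_ord0.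
have reachE : Reach T = \bigcup_i ([set r | T (r i)] : set (play_space s0)).
  by apply/seteqP; split=> [r [i Ti]|r [i _ Ti]]; exists i.
have mR : measurable (Reach T : set (play_space s0)).
  by rewrite reachE; apply: bigcupT_measurable => i; exact: measurable_coordinate.
have hitsE : \bigcup_n hits x 0 n = Reach T `&` cyl x 0.
  apply/seteqP; split=> [r [n _ [rx [i [_ Ti]]]]|r [[i Ti] rx]].
    by split=> //; exists i.
  by exists i.+1 => //; split=> //; exists i; rewrite add0n leqnn.
have <- : P (\bigcup_n hits x 0 n) = P (Reach T).
  rewrite hitsE (measureDI P mR (measurable_cylinder x 0)).
  have mc := measurable_cylinder x 0.
  have PC : P (~` cyl x 0) = 0%E by rewrite probability_setC// Px subee.
  have sub : (Reach T : set (play_space s0)) `\` cyl x 0 `<=` ~` cyl x 0.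
    by move=> r [].
  by rewrite (subset_measure0 (measurableD mR mc) (measurableC mc) sub PC) add0e.
have cvgP : P (hits x 0 n) @[n --> \oo] --> P (\bigcup_n hits x 0 n).
  apply: nondecreasing_cvg_mu => //.
    exact: bigcupT_measurable.
  move=> m n mn; apply/subsetPset => r [rx [i [im Ti]]]; split=> //.
  by exists i; split=> //; rewrite add0n (leq_trans _ mn)//; move: im; rewrite add0n.
apply: (cvg_unique _ cvgP) => //.
have -> : (fun n => P (hits x 0 n)) = EFin \o (fun n => reachn T sigma pi n [::] s0).
  by apply/funext => n; rewrite law_hits//= /path_prob big_ord0 mul1r.
apply: cvg_EFin; first by near=> n.
apply: nondecreasing_cvgn; first by move=> m n; exact: reachn_nd.
by exists 1 => _ [n _ <-]; exact: reachn_le1.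
Unshelve. all: by end_near. Qed.

End PlayLaw.

Lemma play_law_Reach (T : set S) :
  play_law s0 sigma pi (Reach T) = (reach T sigma pi [::] s0)%:E.
Proof. exact: law_Reach play_lawP _. Qed.

End Law.

(** * Optimal strategies and strong MD-determinacy *)

Section Determinacy.
Context (R : realType) (S : countType) (G : game R S) (T : set S).
Context (fb : finitely_branching G).

Let unit01 : 0 <= (1 : R) <= 1. Proof. by rewrite ler01 lexx. Qed.

Let v : S -> R := val G T 1 (fun _ => xpredT) set0.

Let v01 s : 0 <= v s <= 1.
Proof. by rewrite /v val_ge0// val_le1. Qed.

Let v_step s : ~ T s -> v s = opt G (fun _ => xpredT) v s.
Proof. by move=> nT; rewrite {1}/v (val_step fb)// mul1r. Qed.

Lemma box_MD_gt c s : 0 <= c -> c < v s ->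
  exists2 f : S -> S, forall s, f s \in succs G s &
    forall (sigma : strategy G Box) (pi : strategy G Diamond) w,
      plays_by sigma f -> c < reach T sigma pi w s.
Proof.
move=> c0 /(discounted_approx fb c0)[lam [lam01 cs]].
have lam01' : 0 <= lam <= 1 by move: lam01 => /andP[-> /ltW].
set u := val G T lam (fun _ => xpredT) set0 in cs.
have /choice[f fP] := exists_argmin fb (fun s => - u s).
have fS t : f t \in succs G t by case: (fP t).
exists f => // sigma pi w sf.
pose e := (u s - c) / 2; have e0 : 0 < e by rewrite divr_gt0// subr_gt0.
apply: lt_le_trans (_ : c < u s - e) _; first by rewrite /e; lra.
(* The intermediate game leaves the Box player only the edge to [f t], which maximizes the
   discounted value. *)
apply: le_trans (_ : _ <= val G T 1 (fun s y => y == f s) set0 s) _; last first.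
  by apply: val_le_reach sf => // t y /eqP.
apply: (discounted_le_val fb lam01 (ltW e0)) => t ot nT nD _.
exists (f t); split=> //; rewrite -/u.
rewrite {1}/u (val_step fb _ lam01')// ler_wpM2l//; first by case/andP: lam01'.
rewrite /opt ot big_seq; apply: bigmax_le; first exact: val_ge0.
by move=> y ys; rewrite -lerN2; case: (fP t) => _; apply.
Qed.

(** By the fixpoint equation, [v] is a supermartingale when the Diamond player minimizes it. *)
Lemma diamond_MD_le : exists2 h : S -> S, forall s, h s \in succs G s &
  forall (sigma : strategy G Box) (pi : strategy G Diamond) w s,
    plays_by pi h -> reach T sigma pi w s <= v s.
Proof.
have /choice[h hP] := exists_argmin fb v.
have hS t : h t \in succs G t by case: (hP t).
exists h => // sigma pi w s ph.
apply: reach_le_supermartingale => //.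
- by move=> t; case/andP: (v01 t).
- by move=> t Tt; exact: val_target.
move=> w' t nT; rewrite v_step// /opt; case ot : (owner G t) => [[]|].
- by apply: tau_avg_le => // y ys _; exact: le_bigmax_seq.
- apply: tau_avg_le => // y ys ty.
  have -> : y = h t.
    by apply: distr_point (tau_distr sigma pi w' t) (hS t) _ ys ty;
       rewrite ?/tau ?ot ?ph.
  rewrite big_seq; apply: le_bigmin; first by case/andP: (v01 (h t)).
  by case: (hP t).
- by rewrite /tau ot.
Qed.

(** The minimizing strategy of the Diamond player gives the upper bound, and Box strategies that
    secure [v s - e] for each [e > 0] give the lower one. *)
Lemma reach_valueE s : reach_value G T s = (v s)%:E.
Proof.
have [h hS hP] := diamond_MD_le.
apply/eqP; rewrite eq_le; apply/andP; split.
  apply: ge_ereal_sup => _ [sigma _ <-].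
  apply: (@le_trans _ _ (play_law s sigma (positional fb Diamond hS) (Reach T))).
    by apply: ereal_inf_lbound; exists (positional fb Diamond hS).
  rewrite play_law_Reach// lee_fin; apply: hP.
  exact: positional_plays_by.
have H f (fS : forall s, f s \in succs G s) c :
    (forall (sigma : strategy G Box) pi, plays_by sigma f -> c <= reach T sigma pi [::] s) ->
    (c%:E <= reach_value G T s)%E.
  move=> fc; apply: le_ereal_sup_tmp.
  exists (ereal_inf (range (fun pi => play_law s (positional fb Box fS) pi (Reach T)))).
    by exists (positional fb Box fS).
  apply: le_ereal_inf_tmp => _ [pi _ <-].
  by rewrite play_law_Reach// lee_fin; apply: fc; exact: positional_plays_by.
apply/lee_subgt0Pr => e e0; rewrite -EFinB.
have [c0|c0] := leP 0 (v s - e).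
  have [|f fS fc] := box_MD_gt (s := s) c0; first by rewrite gtrBl.
  by apply: (H f fS) => sigma pi sf; apply: ltW; exact: fc.
(* A negative bound is met by any strategy; [h] supplies a choice of successors. *)
apply: (H h hS) => sigma pi _.
by apply: le_trans (ltW c0) _; exact: reach_ge0.
Qed.

Let determined_gt s c rhd : 0 <= c -> c < v s ->
  exists sigma : strategy G Box, is_MD sigma /\
    forall pi, meets_threshold (play_law s sigma pi (Reach T)) rhd c.
Proof.
move=> c0 cs; have [f fS fc] := box_MD_gt c0 cs.
exists (positional fb Box fS); split=> [|pi]; first exact: is_MD_positional.
rewrite play_law_Reach//.
have := fc (positional fb Box fS) pi [::] (positional_plays_by fb fS).
by case: rhd => /=; rewrite ?lee_fin ?lte_fin // => /ltW.
Qed.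

Lemma threshold_MD_determined rhd c : 0 <= c <= 1 ->
  [\/ forall s y, owner G s = Some Box -> succ G s y -> v s <= v y,
      forall s y, owner G s = Some Diamond -> succ G s y -> v y <= v s,
      rhd = Geq /\ c = 1
    | rhd = Gtr] ->
  strongly_MD_determined G (Reach T) rhd c.
Proof.
move=> /andP[c0 c1] H s.
have [cs|vc] := ltP c (v s); first by left; exact: determined_gt.
have [h hS hP] := diamond_MD_le.
have [vc'|cs] := ltP (v s) c.
  right; exists (positional fb Diamond hS); split=> [|sigma].
    exact: is_MD_positional.
  have := hP sigma _ [::] s (positional_plays_by fb hS).
  rewrite play_law_Reach//; case: rhd H => /= _ r_le; apply/negP.
    by rewrite -ltNge lte_fin (le_lt_trans r_le).
  by rewrite -leNgt lee_fin (le_trans r_le).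
have {vc cs} vcE : v s = c by apply/eqP; rewrite eq_le vc cs.
(* At [v s = c], the optimal Diamond strategy already refutes the strict inequality. *)
case: rhd H => H; last first.
  right; exists (positional fb Diamond hS); split=> [|sigma].
    exact: is_MD_positional.
  have := hP sigma _ [::] s (positional_plays_by fb hS).
  by rewrite play_law_Reach// => r_le /=; apply/negP; rewrite -leNgt lee_fin -vcE.
have confined g : (forall s, 0 <= g s <= 1) -> (forall s, T s -> g s = 1) ->
    (forall s p y, owner G s = Some p -> y \in succs G s -> g y <= g s) ->
    (forall s, owner G s = None -> \sum_(y <- succs G s) prob G s y * g y <= g s) ->
    g s = c ->
    (exists sigma : strategy G Box, is_MD sigma /\ forall pi : strategy G Diamond,
       meets_threshold (play_law s sigma pi (Reach T)) Geq c) \/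
    (exists pi : strategy G Diamond, is_MD pi /\ forall sigma : strategy G Box,
       ~ meets_threshold (play_law s sigma pi (Reach T)) Geq c).
  move=> g01 gT gP g_avg gs.
  have [f [k [fS kS fk]]] := confined_MD fb g01 gT gP g_avg.
  have [f_win|k_win] := fk s; [left|right].
    exists (positional fb Box fS); split=> [|pi]; first exact: is_MD_positional.
    rewrite play_law_Reach//= lee_fin -gs; apply: f_win.
    exact: positional_plays_by.
  exists (positional fb Diamond kS); split=> [|sigma]; first exact: is_MD_positional.
  rewrite play_law_Reach//= lee_fin -gs; apply/negP; rewrite -ltNge; apply: k_win.
  exact: positional_plays_by.
case: H => [box|dia|[_ c1E]|//].
(* Without value-decreasing edges of the Box player, all edges preserve [v]. *)
- left.
  have [||||f [E [fS Ef vE]]] := @positional_secure R S G T fb (fun _ => xpredT) set0 v.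
  + exact: v01.
  + by [].
  + move=> t nT _; have vt := v_step nT.
    rewrite /preserving; case ot : (owner G t) => [[]|].
    * split=> [_|y /(mem_succs fb) ys _]; last exact: box ot ys.
      by have [y ys] := has_succs fb t; exists y.
    * by move=> y ys; rewrite vt /opt ot; exact: ge_bigmin_seq.
    * by rewrite {1}vt /opt ot.
  + by [].
  exists (positional fb Box fS); split=> [|pi]; first exact: is_MD_positional.
  rewrite play_law_Reach//= lee_fin -vcE; apply: le_trans (vE s) _.
  apply: val_le_reach Ef _ => //; exact: positional_plays_by.
(* The Box player can never increase [v], by the fixpoint equation, and here neither can the Diamond
   player. *)
- apply: (confined v) => //.
  + by move=> t Tt; exact: val_target.
  + move=> t p y ot ys; have [Tt|nT] := pselect (T t).
      by rewrite /v (val_target fb _ _ unit01 Tt); case/andP: (v01 y).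
    case: p ot => ot; last exact: dia ot ((mem_succs fb t y).1 ys).
    by rewrite [leRHS]v_step// /opt ot; exact: le_bigmax_seq.
  + move=> t ot; have [Tt|nT] := pselect (T t).
      rewrite {2}/v (val_target fb _ _ unit01 Tt).
      have := opt_le1 fb (fun _ => xpredT) t (fun y => proj2 (andP (v01 y))).
      by rewrite /opt ot.
    by rewrite [leRHS]v_step// /opt ot.
- apply: (confined (fun=> 1)) => //= t ot; under eq_bigr do rewrite mulr1.
  by rewrite (distr_sum fb (probP ot)).
Qed.

End Determinacy.

Theorem theorem5 (R : realType) (S : countType) (G : game R S) (T : set S)
    (rhd : comparison_sign) (c : R) :
  finitely_branching G ->
  0 <= c <= 1 ->
  [\/ ~ (exists s t, owner G s = Some Box /\ value_decreasing G T s t),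
      ~ (exists s t, owner G s = Some Diamond /\ value_increasing G T s t),
      rhd = Geq /\ c = 1
    | rhd = Gtr] ->
  strongly_MD_determined G (Reach T) rhd c.
Proof.
move=> fb c01 H; apply: threshold_MD_determined => //.
case: H => [nB|nD|c1|strict].
- apply: Or41 => s y os sy; rewrite leNgt; apply/negP => vy.
  apply: nB; exists s, y; split=> //; split=> //.
  by rewrite !reach_valueE// lte_fin.
- apply: Or42 => s y os sy; rewrite leNgt; apply/negP => vy.
  apply: nD; exists s, y; split=> //; split=> //.
  by rewrite !reach_valueE// lte_fin.
- exact: Or43.
- exact: Or44.
Qed.
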